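(* Let $\tau^\star\in\mathcal{T}$ with $\|\tau^{\star\Gamma}\|_1=1$. Then there exists a state $\rho\in H_{n,+,1}$ such that $\tau^\star$ minimizes the Rains bound for $\rho$ (i.e. $R(\rho)=S(\rho\|\tau^\star)$) if and only if there exists $\phi\in H_n$ such that (i) $\phi$ defines a supporting functional of $\mathcal{T}$ at $\tau^\star$ of the form $\mathrm{Tr}[\phi\tau]\le\mathrm{Tr}[\phi\tau^\star]=1$ for all $\tau\in\mathcal{T}$; (ii) $L_{\tau^\star}^{\ddagger}(\phi)\ge0$; (iii) $\phi$ is zero outside of the support of $\tau^\star$ if $\tau^\star$ is singular, that is, $\phi=P_{\tau^\star}\phi P_{\tau^\star}$. Any such $\rho$ must be of the form $\rho=L_{\tau^\star}^{\ddagger}(\phi)$ with $\phi$ satisfying (i)–(iii). Furthermore, $\phi\ge0$; and in particular, if $\rho>0$, then $\tau^\star$ is also full-rank and $\phi=L_{\tau^\star}(\rho)>0$.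
   Context: Let $n=n_1n_2$ and $\mathbb{C}^n=\mathbb{C}^{n_1}\otimes\mathbb{C}^{n_2}$. $H_n$ denotes the $n\times n$ hermitian matrices, $H_{n,+}$ the positive semidefinite ones, and $H_{n,+,1}$ the positive semidefinite ones of unit trace (states). $A\ge0$ means positive semidefinite, $A>0$ positive definite. $A^\Gamma$ denotes the partial transpose of $A$ with respect to a fixed one of the two tensor factors. $\|A\|_1=\mathrm{Tr}|A|$ is the trace norm and $\mathcal{T}=\{\tau\in H_{n,+}:\|\tau^\Gamma\|_1\le1\}$. The relative entropy of $\rho\in H_{n,+,1}$ and $\sigma\in H_{n,+}$ is $S(\rho\|\sigma)=\mathrm{Tr}[\rho(\log\rho-\log\sigma)]$ (natural logarithm, with $0\log0=0$ and $\log\sigma$ taken on the support of $\sigma$) if $\rho$ is zero outside the support of $\sigma$ (i.e. $\ker\sigma\subseteq\ker\rho$), and $S(\rho\|\sigma)=+\infty$ otherwise. The Rains bound is $R(\rho)=\min_{\tau\in\mathcal{T}}S(\rho\|\tau)$. For $A\in H_{n,+}$ with eigenvalues $a_1,\dots,a_n$, $P_A$ is the orthogonal projection onto the support (range) of $A$, and the linear maps $L_A$ and $L_A^\ddagger$ on $n\times n$ matrices are defined, in an orthonormal eigenbasis of $A$, by entrywise products $L_A(B)=T_A\circ B$ and $L_A^\ddagger(B)=S_A\circ B$, where: if $a_i\ne a_j$ and $a_i,a_j>0$, $[T_A]_{ij}=\frac{\log a_i-\log a_j}{a_i-a_j}$ and $[S_A]_{ij}=\frac{a_i-a_j}{\log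 a_i-\log a_j}$; if $a_i=a_j>0$, $[T_A]_{ij}=1/a_i$ and $[S_A]_{ij}=a_i$; and if $a_i=0$ or $a_j=0$, $[T_A]_{ij}=[S_A]_{ij}=0$. ($L_A^\ddagger$ is the Moore–Penrose inverse of $L_A$, and equals $L_A^{-1}$ when $A>0$.) *)

(* Defs.v *)
From HB Require Import structures.
From mathcomp Require Import all_boot all_order all_algebra.
From mathcomp Require Import spectral sesquilinear.
From mathcomp Require Import complex mxtens.
From mathcomp Require Import boolp classical_sets reals constructive_ereal.
From mathcomp Require Import ereal exp.

Set Implicit Arguments.
Unset Strict Implicit.
Unset Printing Implicit Defensive.

Import Order.TTheory GRing.Theory Num.Theory.

Local Open Scope ring_scope.
Local Open Scope complex_scope.
Local Open Scope sesquilinear_scope.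
Local Open Scope classical_set_scope.

Section Positivity.
Context {R : realType} {n : nat}.
Implicit Types A : 'M[R[i]]_n.

(* In R[i], [0 <= z] says that z is real and nonnegative. *)
Definition psdmx A : Prop :=
  A \is hermsymmx /\ forall v : 'cV[R[i]]_n, 0 <= (v^t* *m A *m v) 0 0.

Definition posdefmx A : Prop :=
  A \is hermsymmx /\
  forall v : 'cV[R[i]]_n, v != 0 -> 0 < (v^t* *m A *m v) 0 0.

Definition state A : Prop := psdmx A /\ \tr A = 1.

End Positivity.

Section SpectralCalculus.
Context {R : realType} {n : nat}.
Implicit Types (A B : 'M[R[i]]_n) (f : R -> R) (k : R -> R -> R).

Definition eigval A (i : 'I_n) : R := complex.Re (spectral_diag A 0 i).

(* For A Hermitian, A = P^-1 diag(a) P with P = spectralmx A unitary: the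
   columns of P^-1 form an orthonormal eigenbasis of A, in which a matrix B has
   the entries of P B P^-1. *)
Definition hermfun f A : 'M[R[i]]_n :=
  invmx (spectralmx A) *m diag_mx (\row_i (f (eigval A i))%:C)
    *m spectralmx A.

Definition eigen_schur k A B : 'M[R[i]]_n :=
  invmx (spectralmx A)
    *m (\matrix_(i, j) ((k (eigval A i) (eigval A j))%:C
          * (spectralmx A *m B *m invmx (spectralmx A)) i j))
    *m spectralmx A.

(* Since [ln 0 = 0], this is the logarithm on the support of A, and 0 on its
   kernel. *)
Definition logmx A := hermfun (@ln R) A.

Definition absmx A := hermfun Num.sqrt (A^t* *m A).

Definition trnorm A : R := complex.Re (\tr (absmx A)).

(* [proj_ortho] projects row vectors onto a row space; the transpositions turn
   it into the orthogonal projection of column vectors onto the range of A. *)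
Definition supp_proj A : 'M[R[i]]_n := (proj_ortho A^T)^T.

Definition log_ddiff (x y : R) : R :=
  if (x == 0) || (y == 0) then 0
  else if x == y then x^-1 else (ln x - ln y) / (x - y).

Definition log_ddiff_inv (x y : R) : R :=
  if (x == 0) || (y == 0) then 0
  else if x == y then x else (x - y) / (ln x - ln y).

Definition Lmap A B := eigen_schur log_ddiff A B.

Definition Lmap_pinv A B := eigen_schur log_ddiff_inv A B.

Definition relent (rho sigma : 'M[R[i]]_n) : \bar R :=
  if `[< forall v : 'cV[R[i]]_n, sigma *m v = 0 -> rho *m v = 0 >]
  then (complex.Re (\tr (rho *m (logmx rho - logmx sigma))))%:E
  else +oo%E.

End SpectralCalculus.

Section Rains.
Context {R : realType} {n1 n2 : nat}.
Implicit Types A rho tau phi : 'M[R[i]]_(n1 * n2).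

(* The indices of C^n1 (x) C^n2 are encoded as in [tensmx]; [side] selects the
   transposed factor ([true]: the first one, [false]: the second one). *)
Definition ptransp (side : bool) A : 'M[R[i]]_(n1 * n2) :=
  \matrix_(i, j)
    let u := mxtens_unindex i in
    let v := mxtens_unindex j in
    if side then A (mxtens_index (v.1, u.2)) (mxtens_index (u.1, v.2))
    else A (mxtens_index (u.1, v.2)) (mxtens_index (v.1, u.2)).

Lemma ptransp_tens side (B : 'M[R[i]]_n1) (C : 'M[R[i]]_n2) :
  ptransp side (tensmx B C) =
  if side then tensmx B^T C else tensmx B C^T.
Proof.
apply/matrixP => i j.
case: (mxtens_indexP i) => i1 i2; case: (mxtens_indexP j) => j1 j2.
by case: side; rewrite /ptransp mxE !mxtens_indexK !tensmxE mxE.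
Qed.

Definition rains_set side : set 'M[R[i]]_(n1 * n2) :=
  [set tau | psdmx tau /\ trnorm (ptransp side tau) <= 1].

(* The minimum is written as an infimum; that tau attains it is expressed by
   [rains_bound side rho = relent rho tau] with tau in [rains_set side]. *)
Definition rains_bound side rho : \bar R :=
  ereal_inf [set relent rho tau | tau in rains_set side].

Definition rains_supporting side tau phi : Prop :=
  (forall t, rains_set side t -> \tr (phi *m t) <= \tr (phi *m tau)) /\
  \tr (phi *m tau) = 1.

Definition rains_dual side tau phi : Prop :=
  [/\ phi \is hermsymmx,
      rains_supporting side tau phi,
      psdmx (Lmap_pinv tau phi)
    & phi = supp_proj tau *m phi *m supp_proj tau].

Definition rains_minimizes side tau rho : Prop :=
  state rho /\ rains_bound side rho = relent rho tau.

End Rains.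

(* Main.v *)
(* Let phi = L_tau(rho), the derivative at tau of sigma |-> Tr[rho log sigma].  If ker tau
   and ker sigma lie in ker rho, then
     Tr[rho (log sigma - log tau)] = Tr[phi sigma] - Tr[rho] - gap,
   where, in the eigenbases of tau (eigenvalues a_i) and sigma (eigenvalues x_k), the gap is
   a combination with nonnegative weights of quadratic forms with kernels
     h(x, a_i, a_j) = x T(a_i, a_j) + (a_j ln a_i - a_i ln a_j) / (a_j - a_i) - ln x.
   Under the shift (x, a, b) -> (x + s, a + s, b + s) such a form has derivative
     - (sum_i c_i (a_i - x) / (a_i + s))^2 / (x + s)
   and it tends to 0 as s -> oo.  Hence the gap is nonnegative (concavity of the logarithm),
   which makes tau a minimizer when phi supports the feasible set at tau; and comparing the
   derivative with that of ln (x + 1 + s) - ln (x + s) shows that along the segment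
   (1 - t) tau + t sigma the gap is O(t^(3/2)), even when tau is singular, which gives the
   supporting inequality for phi when tau is a minimizer. *)

Require Import Defs.
From HB Require Import structures.
From mathcomp Require Import all_boot all_order all_algebra.
From mathcomp Require Import spectral sesquilinear.
From mathcomp Require Import complex mxtens.
From mathcomp Require Import ring lra.
From mathcomp Require Import boolp classical_sets functions reals constructive_ereal.
From mathcomp Require Import ereal exp topology normedtype derive realfun.

Set Implicit Arguments.
Unset Strict Implicit.
Unset Printing Implicit Defensive.

Import Order.TTheory GRing.Theory Num.Theory Num.Def.
Import numFieldNormedType.Exports.

Local Open Scope ring_scope.
Local Open Scope complex_scope.
Local Open Scope sesquilinear_scope.

Local Notation Re := complex.Re.
Local Notation Im := complex.Im.

(** * Quadratic forms with logarithmic kernels *)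

Section Log.
Context {R : realType}.
Implicit Types (x a b s : R).

(* The kernel h of the header, shifted by s: it equals
   - (a - x) (b - x) ln[x + s, a + s, b + s], with a second order divided difference. *)
Definition lnrem x a b s : R :=
  if a == b then (x - a) / (a + s) + ln (a + s) - ln (x + s)
  else ((b - x) * ln (a + s) - (a - x) * ln (b + s)) / (b - a) - ln (x + s).

(** For positive [a] and [b], the affine function of [x] that interpolates [ln] at [a] and [b] (the
    tangent when [a = b]) has slope [log_ddiff a b] and this intercept; [lnrem x a b 0] is thus an
    interpolation error. *)
Definition lnrem0 a b : R :=
  if a == b then ln a - 1 else (b * ln a - a * ln b) / (b - a).

Lemma lnrem_at0 x a b : 0 < a -> 0 < b ->
  lnrem x a b 0 = x * log_ddiff a b + lnrem0 a b - ln x.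
Proof.
move=> a0 b0; rewrite /lnrem /log_ddiff /lnrem0 !addr0 (gt_eqF a0) (gt_eqF b0) /=.
have [->|ab] := eqVneq a b; first by field; rewrite (gt_eqF b0).
have h1 : a - b != 0 by rewrite subr_eq0.
have h2 : b - a != 0 by rewrite subr_eq0 eq_sym.
by field; rewrite h1 h2.
Qed.

Lemma is_derive_shift a s : is_derive s 1 (fun t : R => a + t) 1.
Proof. by have := is_deriveD (is_derive_cst a s 1) (is_derive_id s 1); rewrite add0r. Qed.

Lemma eq_is_derive (f g : R -> R) s (df dg : R) :
  is_derive s 1 f df -> f =1 g -> df = dg -> is_derive s 1 g dg.
Proof. by move=> h /funext <- <-. Qed.

Lemma is_derive_ln_shift a s : 0 < a + s ->
  is_derive s 1 (fun t : R => ln (a + t)) (a + s)^-1.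
Proof.
move=> as0.
have := @is_derive1_comp R (@ln R) (fun t : R => a + t) s _ _
  (is_derive1_ln as0) (is_derive_shift a s).
by rewrite mulr1.
Qed.

Lemma is_derive_inv_shift a s : 0 < a + s ->
  is_derive s 1 (fun t : R => (a + t)^-1) (- (a + s) ^- 2).
Proof.
move=> as0; have H := is_derive_shift a s.
have n0 : a + s != 0 by rewrite gt_eqF.
apply: DeriveDef; first by apply: derivableV.
by rewrite deriveV // derive_val /GRing.scale /= mulr1.
Qed.

(** No logarithm survives, and up to the factor [- 1 / (x + s)] the derivative is a function of [a]
    times the same function of [b]: quadratic forms in this kernel become squares. *)
Lemma is_derive_lnrem x a b s : 0 < x + s -> 0 < a + s -> 0 < b + s ->
  is_derive s 1 (lnrem x a b)
    (- ((a - x) * (b - x) / ((x + s) * (a + s) * (b + s)))).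
Proof.
move=> xs as0 bs; rewrite /lnrem.
have dx := is_derive_ln_shift xs; have da := is_derive_ln_shift as0.
have db := is_derive_ln_shift bs; have di := is_derive_inv_shift as0.
have nx : x + s != 0 by rewrite gt_eqF.
have na : a + s != 0 by rewrite gt_eqF.
have nb : b + s != 0 by rewrite gt_eqF.
have [ab|ab] := eqVneq a b.
  apply: (eq_is_derive (is_deriveB (is_deriveD (is_deriveZ (x - a) di) da) dx)) => //.
  rewrite -ab /GRing.scale /=; field.
  by rewrite nx na.
have h2 : b - a != 0 by rewrite subr_eq0 eq_sym.
apply: (eq_is_derive (is_deriveB (is_deriveZ (b - a)^-1
  (is_deriveB (is_deriveZ (b - x) da) (is_deriveZ (a - x) db))) dx)).
  by move=> t; rewrite [in RHS]mulrC.
rewrite /GRing.scale /=; field.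
by rewrite nx na nb h2.
Qed.

Lemma ln_shift_bound a x : 0 < a -> 0 < x ->
  exists2 K, 0 <= K & forall s, 0 < s -> `|ln (a + s) - ln (x + s)| <= K / s.
Proof.
(* From [ln (1 + u) <= u] with [u = (y - z) / (z + t)]. *)
have H (y z t : R) : 0 < y -> 0 < z -> 0 < t -> ln (y + t) - ln (z + t) <= `|y - z| / t.
  move=> y0 z0 t0; have yt : 0 < y + t by rewrite addr_gt0.
  have zt : 0 < z + t by rewrite addr_gt0.
  rewrite -ln_div ?posrE //.
  have -> : (y + t) / (z + t) = 1 + (y - z) / (z + t) by field; rewrite gt_eqF.
  apply: (@le_trans _ _ ((y - z) / (z + t))).
    apply: le_ln1Dx; rewrite -subr_gt0 opprK.
    have -> : (y - z) / (z + t) + 1 = (y + t) / (z + t) by field; rewrite gt_eqF.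
    by rewrite divr_gt0.
  apply: (@le_trans _ _ (`|y - z| / (z + t))).
    by rewrite ler_pM2r ?invr_gt0 // ler_norm.
  by rewrite ler_wpM2l // lef_pV2 ?posrE // lerDr ltW.
move=> a0 x0; exists `|a - x| => // s s0.
rewrite ler_norml; apply/andP; split; last exact: H.
by rewrite lerNl opprB distrC H.
Qed.

(** The weights [b - x] and [- (a - x)] add up to [b - a], so [ln (x + s)] can be distributed over
    both terms; what remains are differences of shifted logarithms, of order [1 / s]. *)
Lemma lnrem_bound x a b : 0 < x -> 0 < a -> 0 < b ->
  exists2 K, 0 <= K & forall s, 0 < s -> `|lnrem x a b s| <= K / s.
Proof.
move=> x0 a0 b0.
have [Ka Ka0 Ha] := ln_shift_bound a0 x0.
have [Kb Kb0 Hb] := ln_shift_bound b0 x0.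
have [ab|ab] := eqVneq a b.
  exists (`|x - a| + Ka) => [|s s0]; first by rewrite addr_ge0.
  rewrite /lnrem ab eqxx -ab -addrA (le_trans (ler_normD _ _)) // [leRHS]mulrDl lerD //.
    have as0 : 0 < a + s by rewrite addr_gt0.
    rewrite normrM normfV (ger0_norm (ltW as0)) ler_wpM2l // lef_pV2 ?posrE //.
    by rewrite lerDr ltW.
  exact: Ha.
have h2 : b - a != 0 by rewrite subr_eq0 eq_sym.
exists ((`|b - x| * Ka + `|a - x| * Kb) / `|b - a|) => [|s s0].
  by rewrite divr_ge0 // addr_ge0 // mulr_ge0.
rewrite /lnrem (negPf ab).
have -> : ((b - x) * ln (a + s) - (a - x) * ln (b + s)) / (b - a) - ln (x + s) =
  ((b - x) * (ln (a + s) - ln (x + s)) - (a - x) * (ln (b + s) - ln (x + s))) / (b - a).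
  by field.
rewrite normrM normfV mulrAC ler_wpM2r ?invr_ge0 //.
rewrite (le_trans (ler_normB _ _)) // [leRHS]mulrDl !normrM -!mulrA.
by rewrite lerD // ler_wpM2l // ?Ha ?Hb.
Qed.

Lemma decreasing_to0_ge0 (H H' : R -> R) (K : R) :
  (forall s, 0 <= s -> is_derive s 1 H (H' s)) -> (forall s, 0 <= s -> H' s <= 0) ->
  0 <= K ->
  (forall s, 0 < s -> - (K / s) <= H s) -> 0 <= H 0.
Proof.
move=> dH H'0 K0 HK; rewrite leNgt; apply/negP => H0.
(* At this point the lower bound [- (K / s)] equals [K / (K + 1) * H 0], strictly above [H 0],
   against monotonicity. The [+ 1] keeps [s] positive when [K = 0]. *)
pose s : R := (K + 1) / - H 0.
have s0 : 0 < s by rewrite divr_gt0 ?oppr_gt0 // ltr_wpDl.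
have [||c cs] := @MVT R H H' 0 s s0.
- by move=> y /itvP yi; apply: dH; rewrite yi.
- apply: derivable_within_continuous => y /itvP yi.
  by have [] := dH y _; rewrite ?yi.
rewrite subr0 => E.
have : H s <= H 0.
  by rewrite -subr_le0 E mulr_le0_ge0 ?(ltW s0) // H'0 // (itvP cs).
have := HK _ s0; rewrite /s => h1 h2.
have := le_trans h1 h2.
have n1 : K + 1 != 0 by rewrite gt_eqF // ltr_wpDl.
have -> : - (K / ((K + 1) / - H 0)) = K / (K + 1) * H 0.
  by field; rewrite n1 lt_eqF.
rewrite leNgt => /negP; apply.
rewrite -subr_gt0.
have -> : K / (K + 1) * H 0 - H 0 = - H 0 / (K + 1) by field.
by rewrite divr_gt0 ?oppr_gt0 // ltr_wpDl.
Qed.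

Definition qform n (K : 'I_n -> 'I_n -> R) (c : 'I_n -> R) : R :=
  \sum_i \sum_j c i * c j * K i j.

Lemma qformD n (K L : 'I_n -> 'I_n -> R) c :
  qform (fun i j => K i j + L i j) c = qform K c + qform L c.
Proof.
rewrite /qform -big_split; apply: eq_bigr => i _ /=.
by rewrite -big_split; apply: eq_bigr => j _; rewrite mulrDr.
Qed.

Lemma qformZ n k (K : 'I_n -> 'I_n -> R) c :
  qform (fun i j => k * K i j) c = k * qform K c.
Proof.
rewrite /qform mulr_sumr; apply: eq_bigr => i _ /=.
by rewrite mulr_sumr; apply: eq_bigr => j _; rewrite mulrCA.
Qed.

Lemma qform_rank1 n (d c : 'I_n -> R) :
  qform (fun i j => d i * d j) c = (\sum_i c i * d i) ^+ 2.
Proof.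
rewrite expr2 big_distrlr; apply: eq_bigr => i _; apply: eq_bigr => j _.
by rewrite mulrACA.
Qed.

Lemma eq_qform n (K L : 'I_n -> 'I_n -> R) c :
  (forall i j, K i j = L i j) -> qform K c = qform L c.
Proof. by move=> KL; apply: eq_bigr => i _; apply: eq_bigr => j _; rewrite KL. Qed.

Lemma qform_lnrem0 n x (a c : 'I_n -> R) : (forall i, 0 < a i) ->
  qform (fun i j => lnrem x (a i) (a j) 0) c =
  x * qform (fun i j => log_ddiff (a i) (a j)) c +
  qform (fun i j => lnrem0 (a i) (a j)) c - ln x * (\sum_i c i) ^+ 2.
Proof.
move=> a0.
rewrite (eq_qform _ (fun i j => lnrem_at0 x (a0 i) (a0 j))) !qformD qformZ.
congr (_ + _ + _).
rewrite -mulNr -(@eq_bigr _ _ _ _ _ _ (fun i => c i * 1)) => [|i _]; last by rewrite mulr1.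
by rewrite -qform_rank1 -qformZ; apply: eq_qform => i j; rewrite !mulr1.
Qed.

Lemma qform_lnrem_small n x (a c : 'I_n -> R) : 0 < x -> (forall i, 0 < a i) ->
  exists2 K, 0 <= K &
    forall s, 0 < s -> `|qform (fun i j => lnrem x (a i) (a j) s) c| <= K / s.
Proof.
move=> x0 a0.
have /choice [K HK] : forall ij : 'I_n * 'I_n, exists K, 0 <= K /\
    forall s, 0 < s -> `|lnrem x (a ij.1) (a ij.2) s| <= K / s.
  by move=> [i j]; have [K] := lnrem_bound x0 (a0 i) (a0 j); exists K.
exists (\sum_i \sum_j `|c i * c j| * K (i, j)) => [|s s0].
  apply: sumr_ge0 => i _; apply: sumr_ge0 => j _.
  by rewrite mulr_ge0 //; case: (HK (i, j)).
rewrite (le_trans (ler_norm_sum _ _ _)) // mulr_suml ler_sum // => i _.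
rewrite (le_trans (ler_norm_sum _ _ _)) // mulr_suml ler_sum // => j _.
by rewrite normrM -mulrA ler_wpM2l //; have [_ ->] := HK (i, j).
Qed.

Lemma is_derive_qform_lnrem n x (a c : 'I_n -> R) s : 0 < x -> (forall i, 0 < a i) ->
  0 <= s ->
  is_derive s 1 (fun s => qform (fun i j => lnrem x (a i) (a j) s) c)
    (- ((\sum_i c i * ((a i - x) / (a i + s))) ^+ 2 / (x + s))).
Proof.
move=> x0 a0 s0; have xs : 0 < x + s by rewrite ltr_wpDr.
have as0 i : 0 < a i + s by rewrite ltr_wpDr.
have D i j := is_deriveZ (c i * c j) (is_derive_lnrem xs (as0 i) (as0 j)).
apply: (eq_is_derive (is_derive_sum (fun i => is_derive_sum (D i)))).
  move=> t; rewrite fct_sumE; apply: eq_bigr => i _.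
  by rewrite fct_sumE; apply: eq_bigr.
rewrite -qform_rank1 mulrC -mulNr -qformZ; apply: eq_bigr => i _; apply: eq_bigr => j _.
rewrite /GRing.scale /=; field.
by rewrite !gt_eqF.
Qed.

Lemma qform_lnrem_ge0 n x (a c : 'I_n -> R) : 0 < x -> (forall i, 0 < a i) ->
  0 <= qform (fun i j => lnrem x (a i) (a j) 0) c.
Proof.
move=> x0 a0; have [K K0 HK] := qform_lnrem_small c x0 a0.
have dF s (s0 : 0 <= s) := is_derive_qform_lnrem c x0 a0 s0.
apply: (decreasing_to0_ge0 dF _ K0) => s s0.
  by rewrite oppr_le0 divr_ge0 ?sqr_ge0 // addr_ge0 // ltW.
by have := HK s s0; rewrite ler_norml => /andP[].
Qed.

(** The comparison function [M * (ln (x + 1 + s) - ln (x + s))] is nonnegative and falls at least as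
    fast as the form: its derivative is [- M / ((x + s) (x + 1 + s))], and [M] bounds
    [S s ^+ 2 * (x + 1 + s)] for all [s]. *)
Lemma qform_lnrem_le n x B (a c : 'I_n -> R) : 0 < x -> (forall i, 0 < a i) ->
  x <= B -> (forall i, a i <= B) ->
  qform (fun i j => lnrem x (a i) (a j) 0) c <=
  (B + 1) * (\sum_i `|c i * (a i - x)| / a i) ^+ 2 * (ln (x + 1) - ln x).
Proof.
move=> x0 a0 xB aB; have [K K0 HK] := qform_lnrem_small c x0 a0.
set D := \sum_i _; set M := (B + 1) * D ^+ 2.
have B0 : 0 <= B by rewrite (le_trans _ xB) // ltW.
have D0 : 0 <= D by apply: sumr_ge0 => i _; rewrite divr_ge0 // ltW.
have M0 : 0 <= M by rewrite mulr_ge0 ?sqr_ge0 // addr_ge0.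
have x10 : 0 < x + 1 by rewrite addr_gt0.
pose S s := \sum_i c i * ((a i - x) / (a i + s)).
pose H s := M * (ln (x + 1 + s) - ln (x + s)) - qform (fun i j => lnrem x (a i) (a j) s) c.
pose H' s := M * ((x + 1 + s)^-1 - (x + s)^-1) + S s ^+ 2 / (x + s).
have dH s : 0 <= s -> is_derive s 1 H (H' s).
  move=> s0.
  have d1 : 0 < x + 1 + s by rewrite ltr_wpDr.
  have d2 : 0 < x + s by rewrite ltr_wpDr.
  apply: (eq_is_derive (is_deriveB (is_deriveZ M (is_deriveB (is_derive_ln_shift d1)
    (is_derive_ln_shift d2))) (is_derive_qform_lnrem c x0 a0 s0))) => //.
  by rewrite opprK.
have : 0 <= H 0; last by rewrite /H !addr0 subr_ge0.
apply: (decreasing_to0_ge0 dH _ K0) => s s0; last first.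
  have : 0 <= M * (ln (x + 1 + s) - ln (x + s)).
    by rewrite mulr_ge0 // subr_ge0 ler_ln ?posrE ?addr_gt0 // -addrA lerD2l ?lerDr.
  have := HK s s0; rewrite ler_norml => /andP[_].
  by rewrite /H; lra.
have d1 : 0 < x + 1 + s by rewrite ltr_wpDr.
have d2 : 0 < x + s by rewrite ltr_wpDr.
have -> : H' s = - ((M - S s ^+ 2 * (x + 1 + s)) / ((x + s) * (x + 1 + s))).
  by rewrite /H'; field; rewrite !gt_eqF.
rewrite oppr_le0 divr_ge0 //; last by rewrite mulr_ge0 // ltW.
pose S' := \sum_i `|c i * (a i - x)| / (a i + s).
have SS : `|S s| <= S'.
  rewrite (le_trans (ler_norm_sum _ _ _)) // ler_sum // => i _.
  have as0 : 0 < a i + s by rewrite ltr_wpDr.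
  by rewrite mulrA normrM normfV (gtr0_norm as0).
have S'D : S' <= D.
  rewrite ler_sum // => i _; rewrite ler_wpM2l // lef_pV2 ?posrE ?lerDl //.
  by rewrite ltr_wpDr.
(* Of the two factors [S'], one absorbs [x + 1 + s], because
   [(x + 1 + s) / (a i + s) <= (B + 1) / a i]. *)
have S'x : S' * (x + 1 + s) <= (B + 1) * D.
  rewrite mulr_suml mulr_sumr ler_sum // => i _.
  have as0 : 0 < a i + s by rewrite ltr_wpDr.
  rewrite -mulrA [leRHS]mulrCA ler_wpM2l //.
  rewrite -subr_ge0.
  have -> : (B + 1) / a i - (a i + s)^-1 * (x + 1 + s) =
     ((B - x) * a i + (B + 1 - a i) * s) / (a i * (a i + s)).
    by field; rewrite !gt_eqF.
  have := aB i; have := a0 i => h1 h2.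
  apply: divr_ge0; last by rewrite mulr_ge0 // ltW.
  rewrite addr_ge0 // mulr_ge0 ?subr_ge0 //; first exact: ltW.
  by rewrite (le_trans h2) // lerDl.
rewrite subr_ge0 -real_normK ?num_real // expr2 -mulrA.
have S'0 : 0 <= S' := le_trans (normr_ge0 _) SS.
apply: (@le_trans _ _ (S' * (S' * (x + 1 + s)))).
  by apply: ler_pM => //; [rewrite mulr_ge0 // ltW | rewrite ler_wpM2r // ltW].
apply: (@le_trans _ _ (D * ((B + 1) * D))).
  by apply: ler_pM => //; rewrite mulr_ge0 // ltW.
by rewrite /M expr2 mulrCA.
Qed.

(** For large [x] the nonnegative quantity of [qform_lnrem_ge0] is dominated by [x] times this form,
    which therefore cannot be negative. *)
Lemma qform_log_ddiff_ge0 n (a c : 'I_n -> R) : (forall i, 0 < a i) ->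
  0 <= qform (fun i j => log_ddiff (a i) (a j)) c.
Proof.
move=> a0; set X := qform _ _; rewrite leNgt; apply/negP => X0.
pose Y := qform (fun i j => lnrem0 (a i) (a j)) c.
(* Since [x >= 1], the subtracted logarithmic term is nonnegative, and [x * X] lies below [- Y]. *)
pose x := (`|Y| + 1) / - X + 1.
have q0 : 0 < (`|Y| + 1) / - X by rewrite divr_gt0 ?oppr_gt0 // ltr_wpDl.
have x0 : 0 < x by rewrite addr_gt0.
have := qform_lnrem_ge0 c x0 a0; rewrite (qform_lnrem0 _ _ a0) -/X -/Y.
have : 0 <= ln x * (\sum_i c i) ^+ 2.
  by rewrite mulr_ge0 ?sqr_ge0 // ln_ge0 // /x lerDr ltW.
have -> : x * X = - (`|Y| + 1) + X.
  by rewrite /x; field; rewrite lt_eqF.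
have := ler_norm Y.
lra.
Qed.

(* For x = 0 the logarithmic term of [qform_lnrem0] is killed by the hypothesis. *)
Lemma qform_lnrem0_ge0 n (a c : 'I_n -> R) : (forall i, 0 < a i) -> \sum_i c i = 0 ->
  0 <= qform (fun i j => lnrem0 (a i) (a j)) c.
Proof.
move=> a0 c0; set Y := qform _ _; rewrite leNgt; apply/negP => Y0.
pose X := qform (fun i j => log_ddiff (a i) (a j)) c.
have X0 : 0 <= X := qform_log_ddiff_ge0 c a0.
pose x := - Y / (2 * (X + 1)).
have X1 : 0 < X + 1 by rewrite ltr_wpDl.
have x0 : 0 < x by rewrite divr_gt0 ?oppr_gt0 // mulr_gt0.
have := qform_lnrem_ge0 c x0 a0; rewrite (qform_lnrem0 _ _ a0) -/X -/Y c0.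
rewrite expr0n mulr0 subr0.
have : x * X <= x * (X + 1) by rewrite ler_pM2l // lerDl.
have -> : x * (X + 1) = - Y / 2 by rewrite /x; field; rewrite gt_eqF.
lra.
Qed.

(** The logarithm may blow up as [x] tends to 0. Splitting [- ln x = - 4 ln r + ln (r ^+ 4 / x) <= 4
    / r + r ^+ 4 / x], the first term costs one power of [r] against [D <= M * r ^+ 4], and the
    second is cancelled by [D <= M * x]. *)
Lemma small_eigenvalue_bound x B D M (r : R) : 0 < x -> x <= B -> 0 < r -> r <= 1 ->
  0 <= D -> 0 <= M -> D <= M * x -> D <= M * r ^+ 4 ->
  D * (ln (x + 1) - ln x) <= M * (B + 5) * r ^+ 3.
Proof.
move=> x0 xB r0 r1 D0 M0 Dx Dr.
have B0 : 0 <= B by rewrite (le_trans _ xB) // ltW.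
have h1 : ln (x + 1) <= B.
  by rewrite addrC (le_trans _ xB) // le_ln1Dx // (lt_trans _ x0) // ltrN10.
have lnr : 4 * - ln r <= 4 / r.
  rewrite ler_pM2l // -lnV ?posrE //; apply: ltW; apply: ln_sublinear.
  by rewrite invr_gt0.
have h2 : - ln x <= 4 / r + r ^+ 4 / x.
  have : ln (r ^+ 4 / x) <= r ^+ 4 / x.
    by apply: ltW; apply: ln_sublinear; rewrite divr_gt0 // exprn_gt0.
  rewrite ln_div ?posrE ?exprn_gt0 // lnXn //.
  move=> h; rewrite -mulr_natl in h; lra.
apply: (@le_trans _ _ (D * (B + 4 / r) + D * (r ^+ 4 / x))).
  by rewrite -mulrDr ler_wpM2l //; lra.
have B4 : 0 <= B + 4 / r by rewrite addr_ge0 // divr_ge0 // ltW.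
have e1 : D * (B + 4 / r) <= M * r ^+ 4 * (B + 4 / r) by rewrite ler_wpM2r.
have e2 : D * (r ^+ 4 / x) <= M * x * (r ^+ 4 / x).
  by rewrite ler_wpM2r // divr_ge0 ?exprn_ge0 // ltW.
apply: (le_trans (lerD e1 e2)).
have -> : M * r ^+ 4 * (B + 4 / r) + M * x * (r ^+ 4 / x) =
   M * r ^+ 3 * (B * r + 4 + r).
  by field; rewrite !gt_eqF.
rewrite [leRHS]mulrAC ler_wpM2l //.
  by rewrite mulr_ge0 // exprn_ge0 // ltW.
have : B * r <= B by rewrite -[leRHS]mulr1 ler_wpM2l.
lra.
Qed.
End Log.

(** * Real parts, squared moduli and hermitian forms over [R[i]] *)

Section ComplexForms.
Context {R : realType}.
Notation C := R[i].

Lemma cReD (z w : C) : Re (z + w) = Re z + Re w.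
Proof. by case: z w => [? ?] [? ?]. Qed.

Lemma cReN (z : C) : Re (- z) = - Re z.
Proof. by case: z. Qed.

Lemma cReB (z w : C) : Re (z - w) = Re z - Re w.
Proof. by rewrite cReD cReN. Qed.

Lemma cRe_sum I r (P : pred I) (F : I -> C) :
  Re (\sum_(i <- r | P i) F i) = \sum_(i <- r | P i) Re (F i).
Proof. by apply: (big_morph _ cReD). Qed.

Lemma cIm_sum I r (P : pred I) (F : I -> C) :
  Im (\sum_(i <- r | P i) F i) = \sum_(i <- r | P i) Im (F i).
Proof. by apply: (big_morph (@complex.Im R)) => // -[? ?] [? ?]. Qed.

Lemma cReMr (k : R) (z : C) : Re (z * k%:C) = Re z * k.
Proof. by case: z => a b /=; rewrite mulr0 subr0. Qed.

Lemma cReMl (k : R) (z : C) : Re (k%:C * z) = k * Re z.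
Proof. by rewrite mulrC cReMr mulrC. Qed.

Lemma cRe_conjM (z w : C) : Re (conjC z * w) = Re z * Re w + Im z * Im w.
Proof. by case: z w => [a b] [c d] /=; rewrite mulNr opprK. Qed.

Lemma cRe_conj (z : C) : Re (conjC z) = Re z.
Proof. by case: z. Qed.

Lemma conj_real (k : R) : conjC (k%:C) = k%:C.
Proof. by rewrite /real_complex_def; apply/eqP; rewrite eq_complex /= oppr0 !eqxx. Qed.

Definition normsq (z : C) : R := Re z ^+ 2 + Im z ^+ 2.

Lemma normsqE (z : C) : conjC z * z = (normsq z)%:C.
Proof.
case: z => a b; apply/eqP; rewrite eq_complex /= /normsq /=.
by apply/andP; split; apply/eqP; ring.
Qed.

Lemma normsq_ge0 z : 0 <= normsq z.
Proof. by rewrite addr_ge0 ?sqr_ge0. Qed.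

Lemma normsq0 : normsq 0 = 0.
Proof. by rewrite /normsq /= expr0n addr0. Qed.

Lemma normsq_eq0 z : (normsq z == 0) = (z == 0).
Proof. by rewrite paddr_eq0 ?sqr_ge0 // !sqrf_eq0 eq_complex. Qed.

Lemma normsqM z w : normsq (z * w) = normsq z * normsq w.
Proof. by case: z w => [a b] [c d]; rewrite /normsq /=; ring. Qed.

Lemma sqr_Re_le z : Re z ^+ 2 <= normsq z.
Proof. by rewrite lerDl sqr_ge0. Qed.

Lemma sqr_Im_le z : Im z ^+ 2 <= normsq z.
Proof. by rewrite lerDr sqr_ge0. Qed.

(** The real part of the sesquilinear form with real kernel [K], split so that inequalities for real
    quadratic forms apply to the real and imaginary parts of [c] separately. *)
Definition hform n (K : 'I_n -> 'I_n -> R) (c : 'I_n -> C) : R :=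
  qform K (fun i => Re (c i)) + qform K (fun i => Im (c i)).

Lemma hformE n (K : 'I_n -> 'I_n -> R) (c : 'I_n -> C) :
  hform K c = \sum_i \sum_j Re (conjC (c i) * c j) * K i j.
Proof.
rewrite /hform /qform -big_split; apply: eq_bigr => i _ /=.
by rewrite -big_split; apply: eq_bigr => j _ /=; rewrite cRe_conjM mulrDl.
Qed.

End ComplexForms.

(** * Spectral calculus *)

(* Both are locked: unification would otherwise unfold the arithmetic of R[i]. *)
HB.lock Definition adj {R : realType} {m n : nat} (A : 'M[R[i]]_(m, n)) : 'M[R[i]]_(n, m) :=
  A^t*.

HB.lock Definition dg {R : realType} {n : nat} (a : 'I_n -> R) : 'M[R[i]]_n :=
  diag_mx (\row_i (a i)%:C).

Section Adjoint.
Context {R : realType}.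
Notation C := R[i].

Lemma adjE m n (A : 'M[C]_(m, n)) i j : adj A i j = conjC (A j i).
Proof. by rewrite adj.unlock !mxE. Qed.

Lemma adjK m n (A : 'M[C]_(m, n)) : adj (adj A) = A.
Proof. by rewrite adj.unlock trmxCK. Qed.

Lemma adjM m n p (A : 'M[C]_(m, n)) (B : 'M[C]_(n, p)) :
  adj (A *m B) = adj B *m adj A.
Proof. by rewrite adj.unlock trmx_mul map_mxM. Qed.

Lemma adjD m n (A B : 'M[C]_(m, n)) : adj (A + B) = adj A + adj B.
Proof. by apply/matrixP => i j; rewrite mxE !adjE mxE rmorphD. Qed.

Lemma adjZ m n (k : R) (A : 'M[C]_(m, n)) : adj (k%:C *: A) = k%:C *: adj A.
Proof. by apply/matrixP => i j; rewrite mxE !adjE mxE rmorphM /= conj_real. Qed.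

Lemma adj_delta m p (i : 'I_m) (j : 'I_p) : adj (delta_mx i j : 'M[C]_(m, p)) = delta_mx j i.
Proof. by rewrite adj.unlock trmx_delta map_delta_mx. Qed.

End Adjoint.

Section Spectral.
Context {R : realType} {n : nat}.
Notation C := R[i].
Implicit Types (A B P Q U V : 'M[C]_n) (a b : 'I_n -> R).

Lemma hermmxP A : reflect (adj A = A) (A \is hermsymmx).
Proof.
rewrite adj.unlock; apply: (iffP idP) => [/is_hermitianmxP|AA].
  by rewrite expr0 scale1r => {2}->.
by apply/is_hermitianmxP; rewrite expr0 scale1r AA.
Qed.

Record unitary P : Prop := Unitary {
  unitaryE : P *m adj P = 1%:M;
  unitaryC : adj P *m P = 1%:M }.

Lemma unitary_spectral A : unitary (spectralmx A).
Proof.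
have /unitarymxP := spectral_unitarymx A; move: (spectralmx A) => P PP.
split; first by rewrite adj.unlock.
by apply: mulmx1C; rewrite adj.unlock.
Qed.

Lemma invmx_spectral A : invmx (spectralmx A) = adj (spectralmx A).
Proof. by rewrite (invmx_unitary (spectral_unitarymx A)) adj.unlock. Qed.

Lemma adj_unitary P : unitary P -> unitary (adj P).
Proof. by move=> [P1 P2]; split; rewrite adjK. Qed.

Lemma mulmxUK m P (X : 'M[C]_(m, n)) : unitary P -> X *m P *m adj P = X.
Proof. by move=> Pu; rewrite -mulmxA (unitaryE Pu) mulmx1. Qed.

Lemma mulmxKU m P (X : 'M[C]_(m, n)) : unitary P -> X *m adj P *m P = X.
Proof. by move=> Pu; rewrite -mulmxA (unitaryC Pu) mulmx1. Qed.

Lemma mul_unitary P Q : unitary P -> unitary Q -> unitary (P *m Q).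
Proof.
move=> Pu Qu; split; rewrite adjM mulmxA.
  by rewrite (mulmxUK _ Qu) (unitaryE Pu).
by rewrite (mulmxKU _ Pu) (unitaryC Qu).
Qed.

Lemma unitary_sandwich P Y : unitary P -> P *m (adj P *m Y *m P) *m adj P = Y.
Proof. by move=> Pu; rewrite !mulmxA (unitaryE Pu) mul1mx (mulmxUK _ Pu). Qed.

Lemma unitary_sandwichK P A : unitary P -> adj P *m (P *m A *m adj P) *m P = A.
Proof. by move=> Pu; rewrite !mulmxA (unitaryC Pu) mul1mx (mulmxKU _ Pu). Qed.

Lemma mxtrace_unitary P A : unitary P -> \tr (adj P *m A *m P) = \tr A.
Proof. by move=> Pu; rewrite mxtrace_mulC mulmxA (unitaryE Pu) mul1mx. Qed.

Lemma dgE a i j : dg a i j = (i == j)%:R * (a i)%:C.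
Proof. by rewrite dg.unlock !mxE mulr_natl; case: eqP => [->|]. Qed.

Lemma dg_diag a i : dg a i i = (a i)%:C.
Proof. by rewrite dgE eqxx mul1r. Qed.

Lemma eq_dg a b : a =1 b -> dg a = dg b.
Proof. by move=> ab; apply/matrixP => i j; rewrite !dgE ab. Qed.

Lemma adj_dg a : adj (dg a) = dg a.
Proof.
apply/matrixP => i j; rewrite adjE !dgE eq_sym; have [->|_] := eqVneq i j.
  by rewrite !mul1r conj_real.
by rewrite !mul0r rmorph0.
Qed.

Lemma mul_dgE m a (X : 'M[C]_(n, m)) i j : (dg a *m X) i j = (a i)%:C * X i j.
Proof. by rewrite dg.unlock mul_diag_mx !mxE. Qed.

Lemma mul_Edg m a (X : 'M[C]_(m, n)) i j : (X *m dg a) i j = X i j * (a j)%:C.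
Proof. by rewrite dg.unlock mul_mx_diag !mxE. Qed.

Lemma mul_dg a b : dg a *m dg b = dg (fun i => a i * b i).
Proof.
apply/matrixP => i j; rewrite mul_dgE !dgE; case: eqP => [->|_]; last by rewrite !mul0r mulr0.
by rewrite !mul1r rmorphM.
Qed.

Lemma dg1 : dg (fun=> 1) = 1%:M :> 'M[C]_n.
Proof. by apply/matrixP => i j; rewrite dgE !mxE mulr1. Qed.

(** Any unitary diagonalization with real eigenvalues, not only the one chosen by [spectralmx]; this
    covers squares and scalar matrices, whose eigenbasis is known beforehand. *)
Record eigdec A P a : Prop := Eigdec {
  eigdec_unitary : unitary P;
  eigdecE : A = adj P *m dg a *m P }.

Lemma herm_eigdec A : A \is hermsymmx -> eigdec A (spectralmx A) (eigval A).
Proof.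
move=> Ah; split; first exact: unitary_spectral.
have -> : dg (eigval A) = diag_mx (spectral_diag A).
  rewrite dg.unlock; congr diag_mx; apply/rowP => i; rewrite mxE.
  by apply: RRe_real; apply: (mxOverP (hermitian_spectral_diag_real Ah)).
rewrite -invmx_spectral.
exact: (orthomx_spectralP (hermitian_normalmx Ah)).
Qed.

Lemma eigdec_herm A P a : eigdec A P a -> A \is hermsymmx.
Proof. by move=> [Pu ->]; apply/hermmxP; rewrite !adjM adjK adj_dg mulmxA. Qed.

Lemma eigdec_sandwich A P a Q : eigdec A P a ->
  Q *m A *m adj Q = (Q *m adj P) *m dg a *m adj (Q *m adj P).
Proof. by move=> [Pu ->]; rewrite adjM adjK !mulmxA. Qed.

Lemma hermfunE f A : hermfun f A =
  adj (spectralmx A) *m dg (fun i => f (eigval A i)) *m spectralmx A.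
Proof. by rewrite /hermfun invmx_spectral dg.unlock. Qed.

(* The functional calculus does not depend on the diagonalization: a matrix that
   intertwines diag(e) and diag(a) intertwines diag(f(e)) and diag(f(a)). *)
Lemma hermfun_eigdec f A P a : eigdec A P a ->
  hermfun f A = adj P *m dg (fun i => f (a i)) *m P.
Proof.
move=> AP; have AS := herm_eigdec (eigdec_herm AP).
rewrite hermfunE; move: (spectralmx A) (eigval A) AS => S e.
case: AP => Pu AP [Su AS].
have SPu : P *m adj S *m dg e = dg a *m (P *m adj S).
  have := congr1 (fun X => P *m X *m adj S) AS; rewrite {1}AP.
  by rewrite !mulmxA (unitaryE Pu) mul1mx (mulmxUK _ Su) => <-.
have SPf : P *m adj S *m dg (fun i => f (e i)) = dg (fun i => f (a i)) *m (P *m adj S).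
  apply/matrixP => i j; move/matrixP/(_ i j): SPu; rewrite !mul_Edg !mul_dgE /=.
  have [->|/eqP n0] := (P *m adj S) i j =P 0; first by rewrite !(mulr0, mul0r).
  by rewrite mulrC => /(mulIf n0) /complexI ->; rewrite mulrC.
have := congr1 (fun X => adj P *m X *m S) SPf.
by rewrite !mulmxA (unitaryC Pu) mul1mx => ->; rewrite (mulmxKU _ Su).
Qed.

Lemma sum_normsq_row U i : unitary U -> \sum_j normsq (U i j) = 1.
Proof.
move=> /unitaryE/matrixP/(_ i i); rewrite !mxE eqxx => E.
have := congr1 (fun z => Re z) E; rewrite cRe_sum /= => <-; apply: eq_bigr => j _.
by rewrite adjE mulrC normsqE.
Qed.

Lemma sum_normsq_col U j : unitary U -> \sum_i normsq (U i j) = 1.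
Proof.
move=> /adj_unitary/(sum_normsq_row j) <-; apply: eq_bigr => i _.
by rewrite adjE /normsq; case: (U i j) => x y /=; rewrite sqrrN.
Qed.

Lemma diag_entry U a k : (U *m dg a *m adj U) k k = (\sum_i normsq (U k i) * a i)%:C.
Proof.
rewrite mxE rmorph_sum; apply: eq_bigr => i _ /=.
have -> : (normsq (U k i) * a i)%:C = (normsq (U k i))%:C * (a i)%:C by rewrite rmorphM.
by rewrite mul_Edg -normsqE adjE mulrAC [conjC _ * _]mulrC.
Qed.

(** Orthonormality of the columns of [U] removes the off-diagonal entries of the kernel after
    summation over the rows. *)
Lemma hform_diag (K : 'I_n -> 'I_n -> R) U (y : 'I_n -> C) : unitary U ->
  \sum_k hform K (fun i => U k i * y i) = \sum_i normsq (y i) * K i i.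
Proof.
move=> /unitaryC/matrixP UU.
have H i j : \sum_k Re (conjC (U k i * y i) * (U k j * y j)) =
    Re ((i == j)%:R * (conjC (y i) * y j)).
  rewrite -cRe_sum; congr (Re _); have := UU i j; rewrite !mxE => <-.
  rewrite mulr_suml; apply: eq_bigr => k _.
  by rewrite adjE rmorphM mulrACA.
under eq_bigr do rewrite hformE.
rewrite exchange_big; apply: eq_bigr => i _ /=.
rewrite exchange_big (bigD1 i) //= [X in _ + X]big1 => [|j ji].
  by rewrite addr0 -mulr_suml H eqxx mul1r normsqE.
by rewrite -mulr_suml H eq_sym (negPf ji) mul0r /= mul0r.
Qed.

Lemma mxtrace_adj A : \tr (adj A) = conjC (\tr A).
Proof. by rewrite /mxtrace rmorph_sum; apply: eq_bigr => i _; rewrite adjE. Qed.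

Lemma mxtrace_herm_mul A B : A \is hermsymmx -> B \is hermsymmx ->
  \tr (A *m B) = (Re (\tr (A *m B)))%:C.
Proof.
move=> /hermmxP Ah /hermmxP Bh; rewrite RRe_real //; apply/CrealP.
by rewrite -mxtrace_adj adjM Ah Bh mxtrace_mulC.
Qed.

Definition supp_ind a i : R := (a i != 0)%:R.

(** [E] is [A] times its pseudo-inverse, so the rows of [E^T] lie in the row space of [A^T] and are
    fixed by the projection; [A *m E = A] makes the rows of [1%:M - E^T] orthogonal to that
    space. *)
Lemma supp_proj_eigdec A P a : eigdec A P a ->
  supp_proj A = adj P *m dg (supp_ind a) *m P.
Proof.
move=> AP; set E := _ *m P; rewrite /supp_proj; case: (AP) => Pu AE.
have H b : A *m (adj P *m dg b *m P) = adj P *m dg (fun i => a i * b i) *m P.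
  by rewrite AE -mul_dg !mulmxA (mulmxUK _ Pu).
apply: trmx_inj; rewrite trmxK.
have AEA : A *m E = A.
  rewrite H [RHS]AE (@eq_dg _ a) // => i; rewrite /supp_ind.
  by have [->|a0] := eqVneq (a i) 0; rewrite ?mul0r // mulr1.
have E1 : E^T *m proj_ortho A^T = E^T.
  apply: proj_ortho_id.
  have -> : E = A *m (adj P *m dg (fun i => (a i)^-1) *m P).
    rewrite H (@eq_dg _ (supp_ind a)) // => i; rewrite /supp_ind.
    have [->|a0] := eqVneq (a i) 0; first by rewrite mul0r.
    by rewrite mulfV.
  by rewrite trmx_mul submxMl.
have E2 : (1%:M - E^T) *m proj_ortho A^T = 0.
  apply: proj_ortho_0; apply/orthomx1P.
  have -> : (A^T)^t* = A^T.
    have /hermmxP/matrixP Ah := eigdec_herm AP.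
    by apply/matrixP => i j; have := Ah j i; rewrite adjE !mxE.
  by rewrite mulmxBl mul1mx -trmx_mul AEA subrr.
have -> : proj_ortho A^T = ((1%:M - E^T) + E^T) *m proj_ortho A^T.
  by rewrite subrK mul1mx.
by rewrite mulmxDl E2 add0r.
Qed.

Lemma trnorm_eigdec A P a : eigdec A P a -> trnorm A = \sum_i `|a i|.
Proof.
move=> AP; have /hermmxP Ah := eigdec_herm AP; have Pu := eigdec_unitary AP.
have AA : eigdec (A^t* *m A) P (fun i => a i * a i).
  split; first exact: Pu.
  have -> : A^t* = A by rewrite -[RHS]Ah adj.unlock.
  by rewrite (eigdecE AP) -mul_dg !mulmxA (mulmxUK _ Pu).
rewrite /trnorm /absmx (hermfun_eigdec _ AA) (mxtrace_unitary _ Pu).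
rewrite /mxtrace cRe_sum; apply: eq_bigr => i _.
by rewrite dg_diag /= -expr2 sqrtr_sqr.
Qed.

(** The diagonal entries in another orthonormal basis are averages of the eigenvalues, with doubly
    stochastic weights [normsq (U k i)]. *)
Lemma trnorm_pinching A Q : A \is hermsymmx -> unitary Q ->
  \sum_k `|Re ((Q *m A *m adj Q) k k)| <= trnorm A.
Proof.
move=> /herm_eigdec; move: (spectralmx A) (eigval A) => P a AP Qu.
rewrite (trnorm_eigdec AP).
have Uu := mul_unitary Qu (adj_unitary (eigdec_unitary AP)).
rewrite (eigdec_sandwich Q AP).
apply: (@le_trans _ _ (\sum_k \sum_i normsq ((Q *m adj P) k i) * `|a i|)).
  apply: ler_sum => k _; rewrite diag_entry /= (le_trans (ler_norm_sum _ _ _)) //.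
  by apply: ler_sum => i _; rewrite normrM ger0_norm ?normsq_ge0.
rewrite exchange_big; apply: ler_sum => i _.
by rewrite -mulr_suml (sum_normsq_col i Uu) mul1r.
Qed.

Lemma sandwich_conv m p (L : 'M[C]_(m, n)) (M : 'M[C]_(n, p)) A B (s t : R) i j :
  (L *m (s%:C *: A + t%:C *: B) *m M) i j =
  s%:C * (L *m A *m M) i j + t%:C * (L *m B *m M) i j.
Proof.
have -> : L *m (s%:C *: A + t%:C *: B) *m M =
   s%:C *: (L *m A *m M) + t%:C *: (L *m B *m M).
  by rewrite mulmxDr mulmxDl -!scalemxAr -!scalemxAl.
by rewrite !mxE.
Qed.

Lemma herm_conv A B (s t : R) : A \is hermsymmx -> B \is hermsymmx ->
  s%:C *: A + t%:C *: B \is hermsymmx.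
Proof. by move=> /hermmxP Ah /hermmxP Bh; apply/hermmxP; rewrite adjD !adjZ Ah Bh. Qed.

(** In an eigenbasis of the combination, its trace norm is a sum of moduli of diagonal entries, and
    these are linear in the matrix; [trnorm_pinching] bounds the parts from [A] and [B]. *)
Lemma trnorm_convex A B (t : R) : A \is hermsymmx -> B \is hermsymmx -> 0 <= t <= 1 ->
  trnorm ((1 - t)%:C *: A + t%:C *: B) <= (1 - t) * trnorm A + t * trnorm B.
Proof.
move=> Ah Bh /andP[t0 t1].
have := herm_eigdec (herm_conv (1 - t) t Ah Bh).
set D := _ + _; move: (spectralmx D) (eigval D) => Q d DP.
have Qu := eigdec_unitary DP; rewrite (trnorm_eigdec DP).
have t10 : 0 <= 1 - t by rewrite subr_ge0.
apply: (@le_trans _ _ ((1 - t) * (\sum_k `|Re ((Q *m A *m adj Q) k k)|) +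
                       t * (\sum_k `|Re ((Q *m B *m adj Q) k k)|))); last first.
  by apply: lerD; apply: ler_wpM2l => //; apply: trnorm_pinching.
rewrite !mulr_sumr -big_split; apply: ler_sum => k _ /=.
have -> : d k = (1 - t) * Re ((Q *m A *m adj Q) k k) + t * Re ((Q *m B *m adj Q) k k).
  have := congr1 (fun X => Re ((Q *m X *m adj Q) k k)) (eigdecE DP).
  rewrite (unitary_sandwich _ Qu) dg_diag /= => <-.
  by rewrite /D sandwich_conv cReD !cReMl.
rewrite (le_trans (ler_normD _ _)) // !normrM.
by rewrite (ger0_norm t0) (ger0_norm t10).
Qed.

Lemma psdmx_herm A : psdmx A -> A \is hermsymmx.
Proof. by case. Qed.

Lemma psdmxP A : A \is hermsymmx ->
  (forall v : 'cV[C]_n, 0 <= Re ((adj v *m A *m v) 0 0)) -> psdmx A.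
Proof.
move=> Ah A0; split=> // v.
have -> : v^t* = adj v by rewrite adj.unlock.
rewrite -[X in _ <= X]RRe_real ?ler0c //; apply/CrealP.
have /matrixP/(_ 0 0) : adj (adj v *m A *m v) = adj v *m A *m v.
  by rewrite !adjM adjK (hermmxP _ Ah) mulmxA.
by rewrite adjE.
Qed.

Definition eigvec P i : 'cV[C]_n := adj P *m delta_mx i 0.

Lemma eigdec_eigvec A P a i : eigdec A P a ->
  A *m eigvec P i = (a i)%:C *: eigvec P i.
Proof.
move=> [Pu ->]; rewrite /eigvec !mulmxA (mulmxUK _ Pu) -mulmxA scalemxAr; congr (_ *m _).
apply/colP => j; rewrite mul_dgE !mxE.
by have [->|_] := eqVneq j i; rewrite // !mulr0.
Qed.

Lemma eigvec_norm P i : unitary P ->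
  (adj (eigvec P i) *m eigvec P i) 0 0 = 1.
Proof.
move=> Pu; rewrite /eigvec adjM adjK adj_delta mulmxA (mulmxUK _ Pu) mul_delta_mx.
by rewrite mxE !eqxx.
Qed.

Lemma eigdec_rayleigh A P a i : eigdec A P a ->
  (adj (eigvec P i) *m A *m eigvec P i) 0 0 = (a i)%:C.
Proof.
move=> AP; rewrite -mulmxA (eigdec_eigvec _ AP) -scalemxAr mxE.
by rewrite (eigvec_norm _ (eigdec_unitary AP)) mulr1.
Qed.

Lemma psd_eigdec_ge0 A P a i : psdmx A -> eigdec A P a -> 0 <= a i.
Proof.
move=> [_ A0] AP; have := A0 (eigvec P i).
have -> : (eigvec P i)^t* = adj (eigvec P i) by rewrite adj.unlock.
by rewrite (eigdec_rayleigh _ AP) ler0c.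
Qed.

Lemma posdef_eigdec_gt0 A P a i : posdefmx A -> eigdec A P a -> 0 < a i.
Proof.
move=> [_ A0] AP; have := A0 (eigvec P i).
have -> : (eigvec P i)^t* = adj (eigvec P i) by rewrite adj.unlock.
rewrite (eigdec_rayleigh _ AP) ltcR; apply.
apply/eqP => v0; have := eigvec_norm i (eigdec_unitary AP).
rewrite v0 mulmx0 mxE => /esym/eqP.
by rewrite oner_eq0.
Qed.

Lemma qformv_eigdec A P a (v : 'cV[C]_n) : eigdec A P a ->
  Re ((adj v *m A *m v) 0 0) = \sum_i a i * normsq ((P *m v) i 0).
Proof.
move=> [Pu ->].
have -> : adj v *m (adj P *m dg a *m P) *m v = adj (P *m v) *m (dg a *m (P *m v)).
  by rewrite adjM !mulmxA.
rewrite mxE cRe_sum; apply: eq_bigr => i _.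
by rewrite mul_dgE mulrCA cReMl adjE normsqE.
Qed.

Lemma eigdec_psd A P a : eigdec A P a -> (forall i, 0 <= a i) -> psdmx A.
Proof.
move=> AP a0; apply: psdmxP => [|v]; first exact: eigdec_herm AP.
rewrite (qformv_eigdec _ AP); apply: sumr_ge0 => i _.
by rewrite mulr_ge0 // normsq_ge0.
Qed.

Lemma psd_convex A B (t : R) : psdmx A -> psdmx B -> 0 <= t <= 1 ->
  psdmx ((1 - t)%:C *: A + t%:C *: B).
Proof.
move=> [Ah A0] [Bh B0] /andP[t0 t1]; split; first exact: herm_conv.
move=> v; rewrite sandwich_conv.
by rewrite addr_ge0 // mulr_ge0 // ler0c ?subr_ge0.
Qed.

Lemma scalar_eigdec (c : R) : eigdec (c%:C%:M : 'M[C]_n) 1%:M (fun=> c).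
Proof.
have adj1 : adj (1%:M : 'M[C]_n) = 1%:M.
  by rewrite adj.unlock trmx1 map_mx1.
split; first by split; rewrite adj1 mulmx1.
rewrite adj1 mul1mx mulmx1; apply/matrixP => i j.
by rewrite dgE mxE mulr_natl.
Qed.

End Spectral.

(** * Partial transposition and convexity of the feasible set *)

Section RainsSet.
Context {R : realType} {n1 n2 : nat}.
Notation C := R[i].
Implicit Types (A B : 'M[C]_(n1 * n2)) (side : bool).

Lemma ptransp_herm side A : A \is hermsymmx -> ptransp side A \is hermsymmx.
Proof.
move=> /hermmxP/matrixP Ah; apply/hermmxP/matrixP => i j; rewrite adjE !mxE.
by case: side => /=; rewrite -[in RHS]Ah adjE.
Qed.

Lemma ptransp_conv side A B (s t : R) :
  ptransp side (s%:C *: A + t%:C *: B) =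
  s%:C *: ptransp side A + t%:C *: ptransp side B.
Proof. by apply/matrixP => i j; rewrite !mxE; case: side; rewrite /= ?mxE. Qed.

Lemma ptransp_scalar side (c : C) : ptransp side (c%:M : 'M[C]_(n1 * n2)) = c%:M.
Proof.
have inj k l : (mxtens_index k == mxtens_index l :> 'I_(n1 * n2)) = (k == l).
  by apply/eqP/eqP => [/(congr1 (@mxtens_unindex _ _))|->//]; rewrite !mxtens_indexK.
apply/matrixP => i j; case: (mxtens_indexP i) => i1 i2; case: (mxtens_indexP j) => j1 j2.
rewrite /ptransp mxE !mxtens_indexK [RHS]mxE inj.
by case: side; rewrite mxE inj !xpair_eqE // [i1 == j1]eq_sym // [j1 == i1]eq_sym [j2 == i2]eq_sym.
Qed.

Lemma rains_set_convex side A B (t : R) : rains_set side A -> rains_set side B ->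
  0 <= t <= 1 -> rains_set side ((1 - t)%:C *: A + t%:C *: B).
Proof.
move=> [Ap A1] [Bp B1] t01; split; first exact: psd_convex.
have [t0 t1] := andP t01.
rewrite ptransp_conv (le_trans (trnorm_convex _ _ t01)) ?ptransp_herm ?psdmx_herm //.
have E : (1 - t) * 1 + t * 1 = 1 by rewrite !mulr1 subrK.
rewrite -[leRHS]E.
have t10 : 0 <= 1 - t by rewrite subr_ge0.
exact: lerD (ler_wpM2l t10 A1) (ler_wpM2l t0 B1).
Qed.

(** The maximally mixed state is a feasible point without kernel, which will show that the minimum
    is finite. *)
Lemma rains_set_scalar side : (0 < n1 * n2)%N ->
  rains_set side (((n1 * n2)%:R^-1)%:C%:M : 'M[C]_(n1 * n2)).
Proof.
move=> n0; set c : R := _^-1.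
have c0 : 0 <= c by rewrite invr_ge0 ler0n.
split; first by apply: (eigdec_psd (scalar_eigdec c)).
rewrite ptransp_scalar (trnorm_eigdec (scalar_eigdec c)) sumr_const card_ord ger0_norm //.
by rewrite -mulr_natr mulVf // pnatr_eq0 -lt0n.
Qed.

End RainsSet.

(** * Schur multipliers in an orthonormal basis *)

(** The kernel depends on indices rather than on eigenvalues, so that compositions of multipliers
    and sandwiches by support projections have the same form. *)
HB.lock Definition schur {R : realType} {n : nat} (P : 'M[R[i]]_n)
    (K : 'I_n -> 'I_n -> R) (B : 'M[R[i]]_n) : 'M[R[i]]_n :=
  adj P *m (\matrix_(i, j) ((K i j)%:C * (P *m B *m adj P) i j)) *m P.

Section Schur.
Context {R : realType} {n : nat}.
Notation C := R[i].
Implicit Types (A B P Q U V rho sigma tau : 'M[C]_n) (a x l : 'I_n -> R).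
Implicit Types (K L : 'I_n -> 'I_n -> R) (c y : 'I_n -> C).


Lemma eigen_schurE k A B :
  eigen_schur k A B = schur (spectralmx A) (fun i j => k (eigval A i) (eigval A j)) B.
Proof. by rewrite /eigen_schur invmx_spectral schur.unlock. Qed.

Lemma schur_coord P K B i j : unitary P ->
  (P *m schur P K B *m adj P) i j = (K i j)%:C * (P *m B *m adj P) i j.
Proof. by move=> Pu; rewrite schur.unlock (unitary_sandwich _ Pu) mxE. Qed.

Lemma unitary_coordP P A B : unitary P ->
  (forall i j, (P *m A *m adj P) i j = (P *m B *m adj P) i j) -> A = B.
Proof.
move=> Pu AB; rewrite -(unitary_sandwichK A Pu) -(unitary_sandwichK B Pu).
have -> : P *m A *m adj P = P *m B *m adj P by apply/matrixP => i j; exact: AB.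
by [].
Qed.

Lemma schur_mul P K L B : unitary P ->
  schur P K (schur P L B) = schur P (fun i j => K i j * L i j) B.
Proof.
move=> Pu; apply: (unitary_coordP Pu) => i j.
by rewrite (schur_coord K _ _ _ Pu) (schur_coord L _ _ _ Pu) (schur_coord _ B _ _ Pu) mulrA rmorphM.
Qed.

Lemma dg_sandwich P a B : unitary P ->
  (adj P *m dg a *m P) *m B *m (adj P *m dg a *m P) = schur P (fun i j => a i * a j) B.
Proof.
move=> Pu; apply: (unitary_coordP Pu) => i j; rewrite (schur_coord _ _ _ _ Pu).
have -> : P *m (adj P *m dg a *m P *m B *m (adj P *m dg a *m P)) *m adj P =
   dg a *m (P *m B *m adj P) *m dg a.
  by rewrite !mulmxA (unitaryE Pu) mul1mx (mulmxUK _ Pu).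
by rewrite mul_Edg mul_dgE rmorphM mulrAC.
Qed.

Lemma coord_herm P B : B \is hermsymmx ->
  adj (P *m B *m adj P) = P *m B *m adj P.
Proof. by move=> /hermmxP Bh; rewrite !adjM adjK Bh mulmxA. Qed.

Lemma schur_herm P K B : (forall i j, K i j = K j i) -> B \is hermsymmx ->
  schur P K B \is hermsymmx.
Proof.
move=> Ks Bh; apply/hermmxP; rewrite schur.unlock !adjM adjK mulmxA; congr (_ *m _ *m _).
apply/matrixP => i j; rewrite adjE [in LHS]mxE [RHS]mxE rmorphM /= conj_real Ks.
by rewrite -[in RHS](coord_herm P Bh) [in RHS]adjE.
Qed.

Definition wquad (Y : 'M[C]_n) c : C := \sum_i \sum_j conjC (c i) * Y i j * c j.

Lemma adj_sandwich_entry (Y W : 'M[C]_n) m :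
  (adj W *m Y *m W) m m = wquad Y (fun i : 'I_n => W i m).
Proof.
rewrite mxE; under eq_bigr do rewrite mxE mulr_suml.
rewrite exchange_big; apply: eq_bigr => i _; apply: eq_bigr => j _.
by rewrite adjE.
Qed.

(** The trace against [rho] is a mixture over its eigenvectors: column [m] of [P *m adj V] holds the
    coordinates of the [m]-th one in the basis given by [P]. *)
Lemma mxtrace_weighted rho V l P (Y : 'M[C]_n) : eigdec rho V l ->
  Re (\tr (rho *m (adj P *m Y *m P))) =
  \sum_m l m * Re (wquad Y (fun i => (P *m adj V) i m)).
Proof.
move=> [Vu ->].
have -> : \tr (adj V *m dg l *m V *m (adj P *m Y *m P)) =
    \tr (dg l *m (adj (P *m adj V) *m Y *m (P *m adj V))).
  by rewrite adjM adjK -2!(mulmxA (adj V)) mxtrace_mulC !mulmxA.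
rewrite /mxtrace cRe_sum; apply: eq_bigr => m _.
by rewrite mul_dgE cReMl adj_sandwich_entry.
Qed.

Lemma wquad_dg a c : Re (wquad (dg a) c) = \sum_i normsq (c i) * a i.
Proof.
rewrite cRe_sum; apply: eq_bigr => i _.
rewrite (bigD1 i) //= big1 ?addr0 => [|j ji].
  by rewrite dg_diag mulrAC normsqE cReMr.
by rewrite dgE eq_sym (negPf ji) mul0r mulr0 mul0r.
Qed.

(** The spectral decomposition of [adj U *m dg x *m U] into rank one terms turns the Schur product
    into one form with kernel [K] per eigenvector. *)
Lemma wquad_schur_dg K U x c :
  Re (wquad (\matrix_(i, j) ((K i j)%:C * (adj U *m dg x *m U) i j)) c) =
  \sum_k x k * hform K (fun i => U k i * c i).
Proof.
under [RHS]eq_bigr do rewrite hformE mulr_sumr.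
rewrite exchange_big cRe_sum; apply: eq_bigr => i _ /=.
under [RHS]eq_bigr do rewrite mulr_sumr.
rewrite exchange_big cRe_sum; apply: eq_bigr => j _ /=.
rewrite mxE mxE !(mulr_sumr, mulr_suml) cRe_sum; apply: eq_bigr => k _.
rewrite mul_Edg adjE.
have -> : conjC (c i) * ((K i j)%:C * (conjC (U k i) * (x k)%:C * U k j)) * c j =
   (x k)%:C * (conjC (U k i * c i) * (U k j * c j) * (K i j)%:C).
  by rewrite rmorphM; ring.
by rewrite cReMl cReMr.
Qed.

Lemma wquad_schur_vec K (v : 'cV[C]_n) c :
  Re (wquad (\matrix_(i, j) ((K i j)%:C * (v *m adj v) i j)) c) =
  hform K (fun i => conjC (c i) * v i 0).
Proof.
rewrite hformE cRe_sum; apply: eq_bigr => i _.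
rewrite cRe_sum; apply: eq_bigr => j _.
rewrite mxE mxE big_ord1 adjE -[in RHS]cRe_conj -cReMr; congr (Re _).
by rewrite !rmorphM /= !conjCK; ring.
Qed.

Lemma mxtrace_schur P K A B : unitary P -> (forall i j, K i j = K j i) ->
  \tr (schur P K A *m B) = \tr (A *m schur P K B).
Proof.
move=> Pu Ks.
have H (X Y : 'M[C]_n) : \tr (X *m Y) = \tr ((P *m X *m adj P) *m (P *m Y *m adj P)).
  have -> : P *m X *m adj P *m (P *m Y *m adj P) = P *m (X *m Y) *m adj P.
    by rewrite !mulmxA (mulmxKU _ Pu).
  by rewrite [RHS]mxtrace_mulC !mulmxA (unitaryC Pu) mul1mx.
rewrite H [RHS]H; apply: eq_bigr => i _; rewrite !mxE; apply: eq_bigr => j _.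
rewrite (schur_coord _ _ _ _ Pu) (schur_coord _ _ _ _ Pu) (Ks j i).
by rewrite mulrCA mulrA.
Qed.

End Schur.

(** * The gap in the concavity of the logarithm *)

Section Gap.
Context {R : realType} {n : nat}.
Notation C := R[i].
Implicit Types (A B P Q U V rho sigma tau : 'M[C]_n) (a x l : 'I_n -> R).
Implicit Types (K L : 'I_n -> 'I_n -> R) (c y : 'I_n -> C).

Lemma hformD K L c : hform (fun i j => K i j + L i j) c = hform K c + hform L c.
Proof. by rewrite /hform !qformD addrACA. Qed.

Lemma hformZ k K c : hform (fun i j => k * K i j) c = k * hform K c.
Proof. by rewrite /hform !qformZ mulrDr. Qed.

Lemma hform_ones c : hform (fun _ _ => 1) c = normsq (\sum_i c i).
Proof.
have H (d : 'I_n -> R) : qform (fun _ _ => 1) d = (\sum_i d i) ^+ 2.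
  rewrite (@eq_qform _ _ _ (fun i j => 1 * 1)) => [|i j]; last by rewrite mulr1.
  by rewrite qform_rank1; congr (_ ^+ 2); apply: eq_bigr => i _; rewrite mulr1.
by rewrite /hform !H /normsq cRe_sum cIm_sum.
Qed.

Lemma eq_hform K L c : (forall i j, c i != 0 -> c j != 0 -> K i j = L i j) ->
  hform K c = hform L c.
Proof.
move=> KL; rewrite !hformE; apply: eq_bigr => i _; apply: eq_bigr => j _.
have [->|ci] := eqVneq (c i) 0; first by rewrite rmorph0 mul0r /= !mul0r.
have [->|cj] := eqVneq (c j) 0; first by rewrite mulr0 /= !mul0r.
by rewrite KL.
Qed.

(* Zero eigenvalues carry zero weight below; replacing them by 1 keeps the
   kernels in the range where [log_ddiff] is positive definite. *)
Definition pos_eig a i : R := if a i == 0 then 1 else a i.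

Lemma pos_eig_gt0 a i : 0 <= a i -> 0 < pos_eig a i.
Proof. by rewrite /pos_eig le0r; case: eqP => // _ /=. Qed.

Definition gap_kernel z a i j : R :=
  z * log_ddiff (pos_eig a i) (pos_eig a j) + lnrem0 (pos_eig a i) (pos_eig a j) - ln z.

(** Here [U] passes from the eigenbasis of tau to that of sigma, and [y] is one eigenvector of rho
    in the eigenbasis of tau; the gap of the header is the mixture of these numbers over the
    eigenvectors of rho. *)
Definition gap U x a y : R :=
  \sum_k hform (gap_kernel (x k) a) (fun i => U k i * y i).

(** The [lnrem0] part of the kernel does not depend on [k], so [hform_diag] reduces it to its
    diagonal [ln (a i) - 1]; the part [- ln (x k)] is a multiple of the all-ones kernel. *)
Lemma gapE U x a y : unitary U -> (forall i, a i = 0 -> y i = 0) ->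
  gap U x a y =
  \sum_k x k * hform (fun i j => log_ddiff (a i) (a j)) (fun i => U k i * y i)
  + \sum_i normsq (y i) * (ln (a i) - 1)
  - \sum_k ln (x k) * normsq (\sum_i U k i * y i).
Proof.
move=> Uu ay.
have nz i k : U k i * y i != 0 -> pos_eig a i = a i.
  rewrite mulf_eq0 negb_or => /andP[_ yi]; rewrite /pos_eig.
  by case: eqP => // /ay y0; rewrite y0 eqxx in yi.
have -> : \sum_i normsq (y i) * (ln (a i) - 1) =
    \sum_k hform (fun i j => lnrem0 (pos_eig a i) (pos_eig a j)) (fun i => U k i * y i).
  rewrite (hform_diag _ _ Uu); apply: eq_bigr => i _; rewrite /lnrem0 eqxx /pos_eig.
  by case: eqP => // /ay ->; rewrite normsq0 !mul0r.
rewrite -big_split -sumrB; apply: eq_bigr => k _ /=.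
rewrite (hformD (fun i j => _ + _)) hformD hformZ; congr (_ * _ + _ + _).
  by apply: eq_hform => i j ci cj; rewrite (nz _ _ ci) (nz _ _ cj).
rewrite -hform_ones -mulNr -hformZ.
by apply: eq_hform => i j _ _; rewrite mulr1.
Qed.

Lemma hform_log_ddiff_ge0 a c : (forall i, 0 <= a i) ->
  0 <= hform (fun i j => log_ddiff (a i) (a j)) c.
Proof.
move=> a0; pose c' i := if a i == 0 then 0 else c i.
have -> : hform (fun i j => log_ddiff (a i) (a j)) c =
    hform (fun i j => log_ddiff (pos_eig a i) (pos_eig a j)) c'.
  rewrite !hformE; apply: eq_bigr => i _; apply: eq_bigr => j _.
  rewrite /c' /pos_eig.
  have [->|ai] := eqVneq (a i) 0; first by rewrite /log_ddiff eqxx rmorph0 mul0r /= !mul0r mulr0.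
  have [->|aj] := eqVneq (a j) 0; first by rewrite /log_ddiff eqxx orbT !mulr0 /= mul0r.
  by [].
by rewrite addr_ge0 // qform_log_ddiff_ge0 // => i; rewrite pos_eig_gt0.
Qed.

Lemma gap_kernel_lnrem z a i j : (forall i, 0 <= a i) ->
  gap_kernel z a i j = lnrem z (pos_eig a i) (pos_eig a j) 0.
Proof. by move=> a0; rewrite lnrem_at0 ?pos_eig_gt0. Qed.

Lemma gap_ge0 U x a y : (forall i, 0 <= a i) -> (forall k, 0 <= x k) ->
  (forall k, x k = 0 -> \sum_i U k i * y i = 0) ->
  0 <= gap U x a y.
Proof.
move=> a0 x0 xy; apply: sumr_ge0 => k _.
have p0 i : 0 < pos_eig a i by rewrite pos_eig_gt0.
have [xk|xk] := eqVneq (x k) 0; last first.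
  have xk0 : 0 < x k by rewrite lt_neqAle eq_sym xk x0.
  have E d : qform (gap_kernel (x k) a) d =
      qform (fun i j => lnrem (x k) (pos_eig a i) (pos_eig a j) 0) d.
    by apply: eq_qform => i j; rewrite gap_kernel_lnrem.
  by rewrite /hform !E addr_ge0 // qform_lnrem_ge0.
(* Since [ln 0 = 0], the kernel at [x k = 0] is [lnrem0] alone; its form is nonnegative on vectors
   with coordinate sum 0, which [xy] supplies. *)
have E d : qform (gap_kernel (x k) a) d =
    qform (fun i j => lnrem0 (pos_eig a i) (pos_eig a j)) d.
  by apply: eq_qform => i j; rewrite /gap_kernel xk mul0r add0r ln0 // subr0.
have S0 := xy k xk.
rewrite /hform !E addr_ge0 // qform_lnrem0_ge0 //.
  by rewrite -cRe_sum S0.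
by rewrite -cIm_sum S0.
Qed.

Lemma sqr_sum_le (d : 'I_n -> R) : (\sum_i d i) ^+ 2 <= n%:R * \sum_i d i ^+ 2.
Proof.
have S : \sum_i \sum_(j < n) d i ^+ 2 = n%:R * \sum_i d i ^+ 2.
  by rewrite mulr_sumr; apply: eq_bigr => i _; rewrite sumr_const card_ord mulr_natl.
have S' : \sum_(i < n) \sum_j d j ^+ 2 = n%:R * \sum_i d i ^+ 2.
  by rewrite exchange_big S.
have : 2 * (\sum_i d i) ^+ 2 <=
    \sum_i \sum_(j < n) d i ^+ 2 + \sum_(i < n) \sum_j d j ^+ 2.
  rewrite expr2 big_distrlr mulr_sumr -big_split; apply: ler_sum => i _ /=.
  rewrite mulr_sumr -big_split; apply: ler_sum => j _ /=.
  have := sqr_ge0 (d i - d j); rewrite sqrrB; lra.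
rewrite S S'; lra.
Qed.

(** The square of the Frobenius norm. *)
Definition frob (X : 'M[C]_n) : R := \sum_i \sum_j normsq (X i j).

Lemma frobE (X : 'M[C]_n) : (frob X)%:C = \tr (X *m adj X).
Proof.
rewrite rmorph_sum; apply: eq_bigr => i _; rewrite rmorph_sum mxE.
by apply: eq_bigr => j _ /=; rewrite -normsqE adjE mulrC.
Qed.

Lemma frob_unitary P Q (X : 'M[C]_n) : unitary P -> unitary Q -> frob (Q *m X *m adj P) = frob X.
Proof.
move=> Pu Qu; apply: complexI; rewrite !frobE !adjM adjK !mulmxA (mulmxKU _ Pu).
by rewrite -!mulmxA mxtrace_mulC -!mulmxA (unitaryC Qu) mulmx1.
Qed.

Lemma normsq_le_frob (X : 'M[C]_n) i j : normsq (X i j) <= frob X.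
Proof.
rewrite /frob (bigD1 i) //= (bigD1 j) //= -addrA lerDl addr_ge0 ?sumr_ge0 // => k _.
  exact: normsq_ge0.
by apply: sumr_ge0 => *; exact: normsq_ge0.
Qed.

Lemma mxtrace_eigdec A P a : eigdec A P a -> Re (\tr A) = \sum_i a i.
Proof.
move=> [Pu ->]; rewrite (mxtrace_unitary _ Pu) /mxtrace cRe_sum.
by apply: eq_bigr => i _; rewrite dg_diag.
Qed.

Lemma eigval_le_trace A P a i : psdmx A -> eigdec A P a -> a i <= Re (\tr A).
Proof.
move=> Ap AP; rewrite (mxtrace_eigdec AP) (bigD1 i) //= lerDl.
by apply: sumr_ge0 => j _; exact: psd_eigdec_ge0 Ap AP.
Qed.

Lemma mxtrace_conv A B (s t : R) :
  Re (\tr (s%:C *: A + t%:C *: B)) = s * Re (\tr A) + t * Re (\tr B).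
Proof. by rewrite mxtraceD !mxtraceZ cReD !cReMl. Qed.

Lemma psd_diag_sandwich_ge0 A Q k : psdmx A -> 0 <= Re ((Q *m A *m adj Q) k k).
Proof.
move=> Ap; have AP := herm_eigdec (psdmx_herm Ap).
rewrite (eigdec_sandwich Q AP) diag_entry /=; apply: sumr_ge0 => i _.
by rewrite mulr_ge0 ?normsq_ge0 //; exact: psd_eigdec_ge0 Ap AP.
Qed.

(** * Bound of the gap along a segment *)

Section Segment.
Variables (tau sigma P : 'M[C]_n) (a : 'I_n -> R) (y : 'I_n -> C).
Hypotheses (taup : psdmx tau) (sigmap : psdmx sigma) (tauP : eigdec tau P a).
Hypothesis ay : forall i, a i = 0 -> y i = 0.

(** The segment parameter is [t = r ^+ 2], so that the order [3/2] in [t] becomes a cube. For each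
    [k], [qform_lnrem_le] leaves a factor [D] that the overlaps bound by both [M * x k] and
    [M * r ^+ 4], as [small_eigenvalue_bound] requires. *)
Lemma gap_le_cube : exists2 K, 0 <= K & forall (r : R) Q x,
  0 < r -> r ^+ 2 <= 2^-1 ->
  eigdec ((1 - r ^+ 2)%:C *: tau + (r ^+ 2)%:C *: sigma) Q x ->
  gap (Q *m adj P) x a y <= K * r ^+ 3.
Proof.
have a0 i : 0 <= a i by exact: psd_eigdec_ge0 taup tauP.
have p0 i : 0 < pos_eig a i by rewrite pos_eig_gt0.
have Pu := eigdec_unitary tauP.
pose B : R := Re (\tr tau) + Re (\tr sigma) + 1.
have tr0 A : psdmx A -> 0 <= Re (\tr A).
  move=> Ap; have AP := herm_eigdec (psdmx_herm Ap).
  rewrite (mxtrace_eigdec AP); apply: sumr_ge0 => i _.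
  exact: psd_eigdec_ge0 Ap AP.
have trt := tr0 _ taup; have trs := tr0 _ sigmap.
have B0 : 0 <= B by rewrite !addr_ge0.
have aB i : pos_eig a i <= B.
  rewrite /pos_eig /B; have := eigval_le_trace i taup tauP.
  by case: eqP => _; lra.
pose N := frob (sigma - tau).
have N0 : 0 <= N by do 2!(apply: sumr_ge0 => ? _); exact: normsq_ge0.
(* The summand with [N] serves the bound by [r ^+ 4], the one with [B] the bound by [x k]. *)
pose F i := (N / pos_eig a i ^+ 2 + 2 * B ^+ 2 / pos_eig a i ^+ 3) * normsq (y i).
have F0 i : 0 <= F i.
  rewrite mulr_ge0 ?normsq_ge0 // addr_ge0 // divr_ge0 ?exprn_ge0 ?mulr_ge0 ?sqr_ge0 //;
  exact: ltW.
pose M := n%:R * \sum_i F i.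
have M0 : 0 <= M by rewrite mulr_ge0 ?ler0n // sumr_ge0.
pose K1 := (B + 1) * (M * (B + 5)).
have B1 : 0 <= B + 1 by lra.
have B5 : 0 <= B + 5 by lra.
have K10 : 0 <= K1 := mulr_ge0 B1 (mulr_ge0 M0 B5).
exists (n%:R * (K1 + K1)) => [|r Q x r0 r2 tP].
  by rewrite mulr_ge0 ?ler0n // addr_ge0.
set t := r ^+ 2 in tP r2; set taut := _ + _ in tP.
have t0 : 0 <= t by rewrite sqr_ge0.
have t1 : t <= 1 by lra.
have tautp : psdmx taut by apply: psd_convex => //; rewrite t0 t1.
have Qu := eigdec_unitary tP; set U := Q *m adj P.
have x0 k : 0 <= x k by exact: psd_eigdec_ge0 tautp tP.
have xB k : x k <= B.
  have := eigval_le_trace k tautp tP; rewrite mxtrace_conv /B.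
  have : (1 - t) * Re (\tr tau) <= Re (\tr tau) by rewrite ler_piMl // lerBlDr lerDl.
  have : t * Re (\tr sigma) <= Re (\tr sigma) by rewrite ler_piMl.
  lra.
(* [taut] dominates [(1 - t) tau], hence half of [tau]; the diagonal entries at the [k]-th
   eigenvector of [taut] are compared. *)
have Ux k i : normsq (U k i) * a i <= 2 * x k.
  have := congr1 (fun X => Re ((Q *m X *m adj Q) k k)) (eigdecE tP).
  rewrite (unitary_sandwich _ Qu) dg_diag /= sandwich_conv cReD !cReMl.
  rewrite (eigdec_sandwich Q tauP) diag_entry -/U /= => E.
  have h1 := psd_diag_sandwich_ge0 Q k sigmap.
  have h2 : normsq (U k i) * a i <= \sum_j normsq (U k j) * a j.
    rewrite (bigD1 i) //= lerDl; apply: sumr_ge0 => j _.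
    by rewrite mulr_ge0 ?normsq_ge0.
  have h3 : 0 <= normsq (U k i) * a i by rewrite mulr_ge0 ?normsq_ge0.
  have h4 : 0 <= t * Re ((Q *m sigma *m adj Q) k k) by rewrite mulr_ge0.
  rewrite -E.
  have h5 : 2^-1 * (\sum_j normsq (U k j) * a j) <= (1 - t) * (\sum_j normsq (U k j) * a j).
    by rewrite ler_wpM2r //; lra.
  lra.
(* [U] intertwines the two spectra up to [taut - tau = t (sigma - tau)], whose squared Frobenius
   norm is [N * r ^+ 4]. *)
have Ut k i : normsq (U k i) * (a i - x k) ^+ 2 <= N * r ^+ 4.
  have E : (U k i) * ((a i)%:C - (x k)%:C) = - (t%:C * (Q *m (sigma - tau) *m adj P) k i).
    have EE : U *m dg a - dg x *m U = (- t%:C) *: (Q *m (sigma - tau) *m adj P).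
      have -> : U *m dg a = Q *m tau *m adj P.
        by rewrite (eigdecE tauP) /U !mulmxA (mulmxUK _ Pu).
      have -> : dg x *m U = Q *m taut *m adj P.
        by rewrite (eigdecE tP) /U !mulmxA (unitaryE Qu) mul1mx.
      rewrite -mulmxBl -mulmxBr scalemxAl scalemxAr; congr (_ *m _ *m _).
      rewrite /taut; apply/matrixP => p q; rewrite !mxE.
      have -> : (1 - t)%:C = 1 - t%:C by rewrite rmorphB.
      by ring.
    have := congr1 (fun X : 'M_n => X k i) EE; rewrite mxE [X in _ + X]mxE [in RHS]mxE.
    by rewrite mul_Edg mul_dgE mulNr => <-; rewrite mulrBr [(x k)%:C * _]mulrC.
  have nR (z : R) : normsq z%:C = z ^+ 2 by rewrite /normsq /= expr0n addr0.
  have nN (z : C) : normsq (- z) = normsq z by case: z => u v; rewrite /normsq /= !sqrrN.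
  have := congr1 normsq E; rewrite normsqM nN normsqM nR -rmorphB nR => ->.
  rewrite mulrC -exprM ler_wpM2r ?exprn_ge0 //; first exact: ltW.
  by rewrite /N -(frob_unitary (sigma - tau) Pu Qu); exact: normsq_le_frob.
suff H k (d : 'I_n -> R) : (forall i, d i ^+ 2 <= normsq (U k i * y i)) ->
    qform (gap_kernel (x k) a) d <= K1 * r ^+ 3.
  rewrite /gap -mulrA mulr_natl -[X in _ *+ X]card_ord -sumr_const.
  apply: ler_sum => k _; rewrite mulrDl lerD //; apply: H => i.
    exact: sqr_Re_le.
  exact: sqr_Im_le.
(* If [x k = 0], then [Ux] kills [U k i] wherever [a i] is positive and [ay] kills [y i] elsewhere,
   so the whole form vanishes. *)
move=> dU; have [xk|xk] := eqVneq (x k) 0.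
  have d0 i : d i = 0.
    apply/eqP; rewrite -sqrf_eq0 eq_le sqr_ge0 andbT (le_trans (dU i)) // normsqM.
    have [ai|ai] := eqVneq (a i) 0; first by rewrite (ay ai) normsq0 mulr0.
    have := Ux k i; rewrite xk mulr0 => h.
    have ai0 : 0 < a i by rewrite lt_neqAle eq_sym ai a0.
    have : normsq (U k i) <= 0 by rewrite -(ler_pM2r ai0) mul0r.
    by move=> ?; rewrite mulr_le0_ge0 // normsq_ge0.
  have -> : qform (gap_kernel (x k) a) d = 0.
    by apply: big1 => i _; apply: big1 => j _; rewrite d0 !mul0r.
  exact: mulr_ge0 K10 (exprn_ge0 3 (ltW r0)).
have xk0 : 0 < x k by rewrite lt_neqAle eq_sym xk x0.
rewrite (@eq_qform _ _ _ (fun i j => lnrem (x k) (pos_eig a i) (pos_eig a j) 0)); last first.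
  by move=> i j; rewrite gap_kernel_lnrem.
apply: (le_trans (qform_lnrem_le d xk0 p0 (xB k) aB)).
set D := _ ^+ 2.
have term i : (`|d i * (pos_eig a i - x k)| / pos_eig a i) ^+ 2 <= F i * x k /\
              (`|d i * (pos_eig a i - x k)| / pos_eig a i) ^+ 2 <= F i * r ^+ 4.
  rewrite exprMn real_normK ?num_real // exprVn exprMn.
  have q0 := p0 i; have q20 : 0 < pos_eig a i ^+ 2 by rewrite exprn_gt0.
  have q30 : 0 < pos_eig a i ^+ 3 by rewrite exprn_gt0.
  have Y0 := normsq_ge0 (y i).
  have G : d i ^+ 2 * (pos_eig a i - x k) ^+ 2 <=
      normsq (U k i) * (pos_eig a i - x k) ^+ 2 * normsq (y i).
    have := dU i; rewrite normsqM => h.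
    by rewrite [leRHS]mulrAC; apply: ler_wpM2r h; exact: sqr_ge0.
  have [ai|ai] := eqVneq (a i) 0.
    have d0 : d i ^+ 2 = 0.
      apply/eqP; rewrite eq_le sqr_ge0 andbT (le_trans (dU i)) //.
      by rewrite (ay ai) mulr0 normsq0.
    rewrite d0 !mul0r; split; first exact: mulr_ge0 (F0 i) (x0 k).
    exact: mulr_ge0 (F0 i) (exprn_ge0 4 (ltW r0)).
  have pa : pos_eig a i = a i by rewrite /pos_eig (negPf ai).
  split; rewrite ler_pdivrMr //; apply: (le_trans G).
    have -> : F i * x k * pos_eig a i ^+ 2 =
      (N * x k + 2 * B ^+ 2 * x k / pos_eig a i) * normsq (y i).
      by rewrite /F; field; rewrite gt_eqF.
    apply: ler_wpM2r => //.
    apply: (@le_trans _ _ (2 * B ^+ 2 * x k / pos_eig a i)); last first.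
      by rewrite lerDr; exact: mulr_ge0 N0 (x0 k).
    rewrite ler_pdivlMr //.
    have -> : 2 * B ^+ 2 * x k = 2 * x k * B ^+ 2 by ring.
    rewrite [leLHS]mulrAC; apply: ler_pM.
    - exact: mulr_ge0 (normsq_ge0 _) (ltW q0).
    - exact: sqr_ge0.
    - by rewrite pa.
    rewrite -real_normK ?num_real // -[leRHS]real_normK ?num_real //.
    rewrite ler_sqr ?nnegrE // (ger0_norm B0) ler_norml.
    have := xB k; have := aB i; have := x0 k; have := ltW q0.
    by move=> *; apply/andP; split; lra.
  have -> : F i * r ^+ 4 * pos_eig a i ^+ 2 =
      (N * r ^+ 4 + 2 * B ^+ 2 * r ^+ 4 / pos_eig a i) * normsq (y i).
    by rewrite /F; field; rewrite gt_eqF.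
  apply: ler_wpM2r => //; apply: (@le_trans _ _ (N * r ^+ 4)); first by rewrite pa.
  by rewrite lerDl divr_ge0 ?(ltW q0) // !mulr_ge0 ?sqr_ge0 ?exprn_ge0 // ltW.
have n0 : 0 <= n%:R :> R by rewrite ler0n.
have r1 : r <= 1.
  by rewrite -(@ler_sqr R) ?nnegrE ?ler01 ?(ltW r0) // expr1n.
have Dx : D <= M * x k.
  apply: (le_trans (sqr_sum_le _)); rewrite /M -mulrA; apply: ler_wpM2l => //.
  by rewrite mulr_suml; apply: ler_sum => i _; case: (term i).
have Dr : D <= M * r ^+ 4.
  apply: (le_trans (sqr_sum_le _)); rewrite /M -mulrA; apply: ler_wpM2l => //.
  by rewrite mulr_suml; apply: ler_sum => i _; case: (term i).
have S := small_eigenvalue_bound xk0 (xB k) r0 r1 (sqr_ge0 _) M0 Dx Dr.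
have -> : K1 * r ^+ 3 = (B + 1) * (M * (B + 5) * r ^+ 3) by rewrite /K1 !mulrA.
by rewrite -[leLHS]mulrA; apply: ler_wpM2l; [exact: B1 | exact: S].
Qed.

End Segment.
End Gap.

(** * Kernels, supports and the relative entropy identity *)

Section RelativeEntropy.
Context {R : realType} {n : nat}.
Notation C := R[i].
Implicit Types (A B P Q U V rho sigma tau phi : 'M[C]_n) (a x l : 'I_n -> R).

Definition ker_sub A B := forall v : 'cV[C]_n, A *m v = 0 -> B *m v = 0.

Lemma mulmx_delta (X : 'M[C]_n) i m : (X *m delta_mx i (0 : 'I_1)) m 0 = X m i.
Proof. by rewrite -colE mxE. Qed.

(** An eigenvector of [A] at eigenvalue 0 is killed by [B], hence orthogonal to the eigenvectors of
    [B] at nonzero eigenvalues. *)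
Lemma ker_sub_coord A B P a V l i m : eigdec A P a -> eigdec B V l -> ker_sub A B ->
  a i = 0 -> l m = 0 \/ (P *m adj V) i m = 0.
Proof.
move=> AP BV AB ai.
have : B *m eigvec P i = 0 by apply: AB; rewrite (eigdec_eigvec _ AP) ai scale0r.
rewrite (eigdecE BV) => /(congr1 (mulmx V)).
rewrite mulmx0 /eigvec !mulmxA (unitaryE (eigdec_unitary BV)) mul1mx -2!mulmxA.
move/(congr1 (fun X : 'cV[C]_n => X m 0)); rewrite mul_dgE mulmxA mulmx_delta [in RHS]mxE.
move/eqP; rewrite mulf_eq0 => /orP[/eqP lm|/eqP h].
  by left; apply: complexI.
by right; have := adjE (V *m adj P) i m; rewrite h rmorph0 adjM adjK.
Qed.

Lemma mxtrace_weighted_dg rho V l P a : eigdec rho V l ->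
  Re (\tr (rho *m (adj P *m dg a *m P))) =
  \sum_m l m * \sum_i normsq ((P *m adj V) i m) * a i.
Proof.
move=> rV; rewrite (mxtrace_weighted _ _ rV); apply: eq_bigr => m _.
by rewrite wquad_dg.
Qed.

Lemma log_ddiffC (s t : R) : log_ddiff s t = log_ddiff t s.
Proof.
rewrite /log_ddiff orbC eq_sym; case: ifP => // _.
have [->|st] := eqVneq t s => //.
by rewrite -(opprB s t) -(opprB (ln s)) invrN mulrNN.
Qed.

Lemma mxtrace_Lmap_mul tau rho sigma : 
  \tr (Lmap tau rho *m sigma) = \tr (rho *m Lmap tau sigma).
Proof.
rewrite /Lmap !eigen_schurE (mxtrace_schur _ _ (unitary_spectral tau)) // => i j.
exact: log_ddiffC.
Qed.

Lemma mxtrace_Lmap_weighted tau rho sigma Q x V l :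
  eigdec sigma Q x -> eigdec rho V l ->
  Re (\tr (Lmap tau rho *m sigma)) =
  \sum_m l m * \sum_k x k * hform (fun i j => log_ddiff (eigval tau i) (eigval tau j))
    (fun i => (Q *m adj (spectralmx tau)) k i * (spectralmx tau *m adj V) i m).
Proof.
move=> sQ rV; rewrite mxtrace_Lmap_mul /Lmap eigen_schurE schur.unlock.
rewrite (mxtrace_weighted _ _ rV); apply: eq_bigr => m _; congr (_ * _).
rewrite -wquad_schur_dg; congr (Re (wquad _ _)).
apply/matrixP => i j; rewrite [LHS]mxE [RHS]mxE; congr (_ * _).
have -> : spectralmx tau *m sigma *m adj (spectralmx tau) =
   adj (Q *m adj (spectralmx tau)) *m dg x *m (Q *m adj (spectralmx tau)).
  by rewrite (eigdecE sQ) adjM adjK !mulmxA.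
by [].
Qed.

(** The identity of the header, checked eigenvector by eigenvector of [rho]. Those with [l m = 0]
    contribute nothing; the others have no component in the kernel of [tau], so [gapE] applies. *)
Lemma relent_gap tau sigma rho Q x V l :
  tau \is hermsymmx -> eigdec sigma Q x -> eigdec rho V l -> ker_sub tau rho ->
  Re (\tr (rho *m (logmx sigma - logmx tau))) =
  Re (\tr (Lmap tau rho *m sigma)) - Re (\tr rho) -
  \sum_m l m * gap (Q *m adj (spectralmx tau)) x (eigval tau)
    (fun i => (spectralmx tau *m adj V) i m).
Proof.
move=> tauh sQ rV tr; have tP := herm_eigdec tauh.
rewrite (mxtrace_Lmap_weighted tau sQ rV).
have Pu := eigdec_unitary tP.
have -> : Re (\tr rho) = \sum_m l m * \sum_i normsq ((spectralmx tau *m adj V) i m) * 1.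
  by rewrite -(mxtrace_weighted_dg _ _ rV) dg1 mulmx1 (unitaryC Pu) mulmx1.
rewrite mulmxBr linearB /= cReB /logmx (hermfun_eigdec _ tP) (hermfun_eigdec _ sQ).
rewrite !(mxtrace_weighted_dg _ _ rV) -!sumrB; apply: eq_bigr => m _.
have [->|lm] := eqVneq (l m) 0; first by rewrite !mul0r !subr0.
rewrite -!mulrBr; congr (_ * _); rewrite gapE; last first.
- by move=> i ai; case: (ker_sub_coord m tP rV tr ai) => // l0; rewrite l0 eqxx in lm.
- exact: mul_unitary (eigdec_unitary sQ) (adj_unitary Pu).
set X := \sum_k _ * hform _ _.
have -> : \sum_k ln (x k) * normsq (\sum_i (Q *m adj (spectralmx tau)) k i *
     (spectralmx tau *m adj V) i m) = \sum_k normsq ((Q *m adj V) k m) * ln (x k).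
  apply: eq_bigr => k _; rewrite mulrC; congr (normsq _ * _).
  have -> : Q *m adj V = (Q *m adj (spectralmx tau)) *m (spectralmx tau *m adj V).
    by rewrite !mulmxA (mulmxKU _ Pu).
  by rewrite [RHS]mxE.
have -> : \sum_i normsq ((spectralmx tau *m adj V) i m) * (ln (eigval tau i) - 1) =
  \sum_i normsq ((spectralmx tau *m adj V) i m) * ln (eigval tau i) -
  \sum_i normsq ((spectralmx tau *m adj V) i m) * 1.
  by rewrite -sumrB; apply: eq_bigr => i _; rewrite mulrBr.
lra.
Qed.

Lemma ker_sub_mx A B (X : 'M[C]_n) : ker_sub A B -> A *m X = 0 -> B *m X = 0.
Proof.
move=> AB AX; apply/matrixP => i j.
have H (M : 'M[C]_n) : (M *m X) i j = (M *m col j X) i 0.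
  by rewrite colE mulmxA mulmx_delta.
rewrite H AB; first by rewrite !mxE.
by rewrite colE mulmxA AX mul0mx.
Qed.

Lemma supp_proj_herm A P a : eigdec A P a -> adj (supp_proj A) = supp_proj A.
Proof. by move=> AP; rewrite (supp_proj_eigdec AP) !adjM adjK adj_dg mulmxA. Qed.

Lemma supp_proj_idem A P a : eigdec A P a -> supp_proj A *m supp_proj A = supp_proj A.
Proof.
move=> AP; rewrite (supp_proj_eigdec AP); have Pu := eigdec_unitary AP.
rewrite !mulmxA (mulmxUK _ Pu) -[_ *m dg _ *m dg _]mulmxA mul_dg.
congr (_ *m _ *m _); apply: eq_dg => i.
by rewrite /supp_ind; case: eqP; rewrite ?mul0r ?mulr1.
Qed.

Lemma mul_supp_proj A P a : eigdec A P a -> A *m supp_proj A = A.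
Proof.
move=> AP; rewrite (supp_proj_eigdec AP); have Pu := eigdec_unitary AP.
rewrite [in LHS](eigdecE AP) !mulmxA (mulmxUK _ Pu) -[_ *m dg a *m _]mulmxA mul_dg.
rewrite [RHS](eigdecE AP); congr (_ *m _ *m _); apply: eq_dg => i.
by rewrite /supp_ind; have [->|_] := eqVneq (a i) 0; rewrite ?mul0r // mulr1.
Qed.

Lemma supp_proj_ker A P a (v : 'cV[C]_n) : eigdec A P a -> A *m v = 0 -> supp_proj A *m v = 0.
Proof.
move=> AP Av; have Pu := eigdec_unitary AP.
have -> : supp_proj A = (adj P *m dg (fun i => (a i)^-1) *m P) *m A.
  rewrite (supp_proj_eigdec AP) [in RHS](eigdecE AP) !mulmxA (mulmxUK _ Pu).
  rewrite -[_ *m _ *m dg a]mulmxA mul_dg; congr (_ *m _ *m _); apply: eq_dg => i.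
  by rewrite /supp_ind; have [->|n0] := eqVneq (a i) 0; rewrite ?mulr0 // mulVf.
by rewrite -mulmxA Av mulmx0.
Qed.

(** [tau] annihilates the range of [1%:M - supp_proj tau], hence so does [rho]; the adjoint gives
    the other side. *)
Lemma ker_sub_supp tau rho P a : eigdec tau P a -> rho \is hermsymmx -> ker_sub tau rho ->
  supp_proj tau *m rho *m supp_proj tau = rho.
Proof.
move=> tP /hermmxP rh tr.
have rE : rho *m supp_proj tau = rho.
  have : rho *m (1%:M - supp_proj tau) = 0.
    by apply: (ker_sub_mx tr); rewrite mulmxBr mulmx1 (mul_supp_proj tP) subrr.
  by rewrite mulmxBr mulmx1 => /subr0_eq.
have := congr1 adj rE; rewrite adjM rh (supp_proj_herm tP) => ->.
exact: rE.
Qed.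

Lemma supp_ker_sub tau rho P a : eigdec tau P a ->
  supp_proj tau *m rho *m supp_proj tau = rho -> ker_sub tau rho.
Proof. by move=> tP E v tv; rewrite -E -mulmxA (supp_proj_ker tP tv) mulmx0. Qed.

Lemma log_ddiff_mul_inv (s t : R) : 0 <= s -> 0 <= t ->
  log_ddiff s t * log_ddiff_inv s t = (s != 0)%:R * (t != 0)%:R.
Proof.
move=> s0 t0; rewrite /log_ddiff /log_ddiff_inv.
have [->|sn] := eqVneq s 0; first by rewrite !mul0r.
have [->|tn] := eqVneq t 0; first by rewrite !mulr0.
have [->|st] := eqVneq s t => /=; first by rewrite mulVf // mulr1.
have sp : 0 < s by rewrite lt_neqAle eq_sym sn.
have tp : 0 < t by rewrite lt_neqAle eq_sym tn.
have h : ln s - ln t != 0.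
  by rewrite subr_eq0; apply: contra_neq st => /ln_inj ->; rewrite ?posrE.
have h' : s - t != 0 by rewrite subr_eq0.
by rewrite mulr1; field; rewrite h h'.
Qed.

(** * The maps [Lmap] and [Lmap_pinv] at a positive semidefinite [tau] *)

Section Fixed.
Variable tau : 'M[C]_n.
Hypothesis taup : psdmx tau.
Let P := spectralmx tau.
Let a := eigval tau.
Let tP : eigdec tau P a := herm_eigdec (psdmx_herm taup).
Let Pu : unitary P := eigdec_unitary tP.

Lemma eigval_psd_ge0 i : 0 <= eigval tau i.
Proof. exact: psd_eigdec_ge0 taup tP. Qed.

(** The two kernels multiply to the indicator of nonzero eigenvalues in both indices, and that
    multiplier is the sandwich by the support projection. *)
Lemma Lmap_pinvK phi : Lmap tau (Lmap_pinv tau phi) = supp_proj tau *m phi *m supp_proj tau.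
Proof.
rewrite /Lmap /Lmap_pinv !eigen_schurE (schur_mul _ _ _ Pu) (supp_proj_eigdec tP) (dg_sandwich _ _ Pu).
congr (schur _ _ _); apply/funext => i; apply/funext => j.
by rewrite log_ddiff_mul_inv ?eigval_psd_ge0.
Qed.

Lemma Lmap_K phi : Lmap_pinv tau (Lmap tau phi) = supp_proj tau *m phi *m supp_proj tau.
Proof.
rewrite /Lmap /Lmap_pinv !eigen_schurE (schur_mul _ _ _ Pu) (supp_proj_eigdec tP) (dg_sandwich _ _ Pu).
congr (schur _ _ _); apply/funext => i; apply/funext => j.
by rewrite mulrC log_ddiff_mul_inv ?eigval_psd_ge0.
Qed.

Lemma supp_Lmap phi : supp_proj tau *m Lmap tau phi *m supp_proj tau = Lmap tau phi.
Proof.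
rewrite /Lmap !eigen_schurE (supp_proj_eigdec tP) (dg_sandwich _ _ Pu) (schur_mul _ _ _ Pu).
congr (schur _ _ _); apply/funext => i; apply/funext => j.
rewrite /supp_ind /log_ddiff -/a; have [->|_] := eqVneq (a i) 0; first by rewrite mulr0.
by have [->|_] := eqVneq (a j) 0; rewrite ?mulr0 ?mul1r.
Qed.

Lemma supp_Lmap_pinv phi :
  supp_proj tau *m Lmap_pinv tau phi *m supp_proj tau = Lmap_pinv tau phi.
Proof.
rewrite /Lmap_pinv !eigen_schurE (supp_proj_eigdec tP) (dg_sandwich _ _ Pu) (schur_mul _ _ _ Pu).
congr (schur _ _ _); apply/funext => i; apply/funext => j.
rewrite /supp_ind /log_ddiff_inv -/a; have [->|_] := eqVneq (a i) 0; first by rewrite mulr0.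
by have [->|_] := eqVneq (a j) 0; rewrite ?mulr0 ?mul1r.
Qed.

Lemma Lmap_herm phi : phi \is hermsymmx -> Lmap tau phi \is hermsymmx.
Proof. by rewrite /Lmap eigen_schurE; apply: schur_herm => i j; exact: log_ddiffC. Qed.

Lemma Lmap_self : Lmap tau tau = supp_proj tau.
Proof.
rewrite /Lmap eigen_schurE (supp_proj_eigdec tP); apply: (unitary_coordP Pu) => i j.
rewrite (schur_coord _ _ _ _ Pu) (unitary_sandwich _ Pu).
have -> : P *m tau *m adj P = dg a by rewrite [in LHS](eigdecE tP) (unitary_sandwich _ Pu).
rewrite !dgE /supp_ind -/a; have [->|_] := eqVneq i j; last by rewrite !mul0r mulr0.
rewrite !mul1r -rmorphM /log_ddiff orbb eqxx; congr (_%:C).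
by have [->|n0] := eqVneq (a j) 0; rewrite ?mul0r // mulVf.
Qed.

(** [Lmap tau] is self-adjoint for the trace pairing and sends [tau] to its support projection. This
    is the normalization of the supporting functional. *)
Lemma mxtrace_Lmap_self rho : supp_proj tau *m rho *m supp_proj tau = rho ->
  \tr (Lmap tau rho *m tau) = \tr rho.
Proof.
move=> E; rewrite mxtrace_Lmap_mul Lmap_self.
rewrite -[in RHS]E [RHS]mxtrace_mulC mulmxA (supp_proj_idem tP).
exact: mxtrace_mulC.
Qed.

(* Tr[phi v v^*] is moved onto the Schur multiplier of the rank one matrix v v^*. *)
Lemma qformv_Lmap rho V l (v : 'cV[C]_n) : eigdec rho V l ->
  Re ((adj v *m Lmap tau rho *m v) 0 0) =
  \sum_m l m * hform (fun i j => log_ddiff (a i) (a j))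
    (fun i => conjC ((P *m adj V) i m) * (P *m v) i 0).
Proof.
move=> rV.
have H (L : 'M[C]_n) : (adj v *m L *m v) 0 0 = \tr (L *m (v *m adj v)).
  by rewrite mulmxA mxtrace_mulC mulmxA trace_mx11.
rewrite H mxtrace_Lmap_mul /Lmap eigen_schurE schur.unlock (mxtrace_weighted _ _ rV).
apply: eq_bigr => m _; rewrite -wquad_schur_vec -/P; congr (_ * Re (wquad _ _)).
apply/matrixP => i j; rewrite [LHS]mxE [RHS]mxE; congr (_ * _).
by rewrite adjM !mulmxA.
Qed.

(** A Schur multiplier with a positive semidefinite kernel, here [log_ddiff], preserves
    positivity. *)
Lemma Lmap_psd rho : psdmx rho -> psdmx (Lmap tau rho).
Proof.
move=> rp; have rV := herm_eigdec (psdmx_herm rp).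
apply: psdmxP => [|v]; first exact: Lmap_herm (psdmx_herm rp).
rewrite (qformv_Lmap _ rV); apply: sumr_ge0 => m _; apply: mulr_ge0.
  exact: psd_eigdec_ge0 rp rV.
by apply: hform_log_ddiff_ge0 => i; exact: eigval_psd_ge0.
Qed.

Lemma Lmap_posdef rho : (forall i, a i != 0) -> posdefmx rho -> posdefmx (Lmap tau rho).
Proof.
move=> a0 rp; have rV := herm_eigdec (rp.1).
have lp i := posdef_eigdec_gt0 i rp rV.
have rpsd : psdmx rho by apply: (eigdec_psd rV) => i; exact: ltW.
have [Lh L0] := Lmap_psd rpsd; split=> // v v0.
rewrite lt_neqAle L0 andbT eq_sym; apply: contraNneq v0 => Lv.
have : Re ((adj v *m Lmap tau rho *m v) 0 0) = 0 by rewrite adj.unlock Lv.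
pose h m := hform (fun i j => log_ddiff (a i) (a j))
    (fun i => conjC ((P *m adj (spectralmx rho)) i m) * (P *m v) i 0).
rewrite (qformv_Lmap _ rV) -[X in X = _]/(\sum_m eigval rho m * h m) => /eqP.
have h0 m : 0 <= h m by apply: hform_log_ddiff_ge0 => i; exact: eigval_psd_ge0.
rewrite psumr_eq0 => [/allP H|m _]; last by rewrite mulr_ge0 // ltW.
have {}H m : h m = 0.
  by have := H m (mem_index_enum m); rewrite mulf_eq0 (gt_eqF (lp m)) /= => /eqP.
(* Without the weights the sum runs over an orthonormal basis, so only the diagonal entries
   [1 / a i] of the kernel remain, and these are positive. *)
have : \sum_m h m = 0 by apply: big1 => m _.
rewrite /h (eq_bigr (fun m => hform (fun i j => log_ddiff (a i) (a j))
    (fun i => adj (P *m adj (spectralmx rho)) m i * (P *m v) i 0))); last first.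
  by move=> m _; congr (hform _ _); apply/funext => i; rewrite adjE.
rewrite hform_diag; last first.
  exact: adj_unitary (mul_unitary Pu (adj_unitary (eigdec_unitary rV))).
move/eqP; rewrite psumr_eq0 => [/allP G|i _]; last first.
  apply: mulr_ge0; first exact: normsq_ge0.
  rewrite /log_ddiff orbb eqxx; case: ifP => // _.
  by rewrite invr_ge0 eigval_psd_ge0.
have Pv : P *m v = 0.
  apply/colP => i; rewrite [RHS]mxE; have := G i (mem_index_enum i).
  rewrite /log_ddiff orbb eqxx (negPf (a0 i)) mulf_eq0 invr_eq0 (negPf (a0 i)) orbF.
  by rewrite normsq_eq0 => /eqP.
by rewrite -[v]mul1mx -(unitaryC Pu) -mulmxA Pv mulmx0.
Qed.

End Fixed.

End RelativeEntropy.

(** * Optimality conditions for the Rains bound *)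

Section Kernels.
Context {R : realType} {n : nat}.
Notation C := R[i].
Implicit Types (A B rho sigma tau phi : 'M[C]_n).

Lemma psd_ker A (v : 'cV[C]_n) : psdmx A -> Re ((adj v *m A *m v) 0 0) = 0 -> A *m v = 0.
Proof.
move=> Ap; have := herm_eigdec (psdmx_herm Ap).
move: (spectralmx A) (eigval A) => P a AP.
have a0 i := psd_eigdec_ge0 i Ap AP.
rewrite (qformv_eigdec v AP) => /eqP; rewrite psumr_eq0 => [/allP H|i _]; last first.
  by rewrite mulr_ge0 // normsq_ge0.
rewrite (eigdecE AP) -2!mulmxA.
have -> : dg a *m (P *m v) = 0; last by rewrite mulmx0.
apply/colP => i; rewrite mul_dgE [RHS]mxE; have := H i (mem_index_enum i).
by rewrite mulf_eq0 normsq_eq0 => /orP[/eqP->|/eqP->]; rewrite ?mul0r ?mulr0.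
Qed.

(** A vanishing sum of nonnegative forms has vanishing terms, and [A] has positive weight. This
    keeps the relative entropy finite along the segment. *)
Lemma segment_ker A B (t : R) : psdmx A -> psdmx B -> 0 <= t -> t < 1 ->
  ker_sub ((1 - t)%:C *: A + t%:C *: B) A.
Proof.
move=> Ap Bp t0 t1 v Dv; apply: psd_ker => //.
have : Re ((adj v *m ((1 - t)%:C *: A + t%:C *: B) *m v) 0 0) = 0.
  by rewrite -mulmxA Dv mulmx0 mxE.
have qpos M : psdmx M -> 0 <= Re ((adj v *m M *m v) 0 0).
  by move=> [_ /(_ v)]; rewrite adj.unlock lecE => /andP[].
rewrite sandwich_conv cReD !cReMl => /eqP.
have t10 : 0 < 1 - t by rewrite subr_gt0.
rewrite paddr_eq0; last by rewrite mulr_ge0 ?qpos.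
  by rewrite mulf_eq0 gt_eqF //= => /andP[/eqP].
by rewrite mulr_ge0 ?qpos // ltW.
Qed.

Lemma relentE rho sigma : ker_sub sigma rho ->
  relent rho sigma = (Re (\tr (rho *m (logmx rho - logmx sigma))))%:E.
Proof. by move=> h; rewrite /relent asboolT. Qed.

Lemma relentNE rho sigma : ~ ker_sub sigma rho -> relent rho sigma = +oo%E.
Proof. by move=> h; rewrite /relent asboolF. Qed.

Lemma relent_leE rho sigma tau : ker_sub sigma rho -> ker_sub tau rho ->
  (relent rho tau <= relent rho sigma)%E =
  (Re (\tr (rho *m (logmx sigma - logmx tau))) <= 0).
Proof.
move=> hs ht; rewrite (relentE hs) (relentE ht) lee_fin.
move: (logmx rho) (logmx sigma) (logmx tau) => X Y Z.
have H M N : Re (\tr (rho *m (M - N))) = Re (\tr (rho *m M)) - Re (\tr (rho *m N)).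
  by rewrite mulmxBr raddfB /= cReB.
by rewrite !H; apply/idP/idP; lra.
Qed.

(** Division by [r ^+ 2] gives [v - u <= K * r], and [r] may be taken small. *)
Lemma segment_descent (K u v : R) : 0 <= K ->
  (forall r, 0 < r -> r ^+ 2 <= 2^-1 -> (1 - r ^+ 2) * u + r ^+ 2 * v - u <= K * r ^+ 3) ->
  v <= u.
Proof.
move=> K0 H; rewrite leNgt; apply/negP => uv.
pose w := v - u; have w0 : 0 < w by rewrite subr_gt0.
(* With [r = w / (2 (K + w))] both [r <= 1/2] and [K * r <= w / 2] hold. *)
pose d := 2 * (K + w); have d0 : 0 < d by rewrite mulr_gt0 // ltr_wpDl.
pose r := w / d; have r0 : 0 < r by rewrite divr_gt0.
have r12 : r <= 2^-1.
  by rewrite /r ler_pdivrMr // /d mulrA mulVf ?mul1r ?lerDr // pnatr_eq0.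
have r2 : r ^+ 2 <= 2^-1.
  rewrite expr2 (le_trans (ler_wpM2l (ltW r0) r12)) // ler_piMl //; lra.
have := H r r0 r2.
have -> : (1 - r ^+ 2) * u + r ^+ 2 * v - u = r ^+ 2 * w by rewrite /w; ring.
have -> : K * r ^+ 3 = r ^+ 2 * (K * r) by ring.
rewrite ler_pM2l ?exprn_gt0 //.
have : K * r < w; last by lra.
have : K * r <= w / 2.
  rewrite /r /d mulrA ler_pdivrMr //.
  have -> : w / 2 * (2 * (K + w)) = K * w + w * w by field.
  by rewrite lerDl mulr_ge0 // ltW.
lra.
Qed.

End Kernels.

(** * Necessity and sufficiency of the dual certificate at a fixed [tau] *)

Section Theorem10.
Context {R : realType} {n1 n2 : nat} (side : bool).
Notation C := R[i].
Variable (tau : 'M[C]_(n1 * n2)).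
Hypotheses (htau : rains_set side tau) (htau1 : trnorm (ptransp side tau) = 1).

Let taup : psdmx tau := htau.1.
Let tP : eigdec tau (spectralmx tau) (eigval tau) := herm_eigdec (psdmx_herm taup).

(** In dimension 0 the trace norm is an empty sum and cannot be 1. *)
Lemma dim_gt0 : (0 < n1 * n2)%N.
Proof.
rewrite lt0n; apply/eqP => n0; have := htau1.
rewrite (trnorm_eigdec (herm_eigdec (ptransp_herm side (psdmx_herm taup)))).
rewrite big1 => [/esym/eqP|i _]; first by rewrite oner_eq0.
by have := ltn_ord i; rewrite [X in (_ < X)%N]n0.
Qed.

Lemma rains_minimizes_le rho sigma : rains_minimizes side tau rho ->
  rains_set side sigma -> (relent rho tau <= relent rho sigma)%E.
Proof.
move=> [_ <-] hs; apply: ereal_inf_lbound; by exists sigma.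
Qed.

(** Otherwise the minimum would be infinite, while the maximally mixed state gives a finite
    value. *)
Lemma rains_minimizes_ker rho : rains_minimizes side tau rho -> ker_sub tau rho.
Proof.
move=> hr; have h := rains_minimizes_le hr (rains_set_scalar side dim_gt0).
apply: contrapT => /relentNE E; move: h; rewrite E relentE ?leye_eq // => v.
rewrite mul_scalar_mx => /eqP; rewrite scaler_eq0 => /orP[|/eqP->]; last by rewrite mulmx0.
rewrite eq_complex /= eqxx andbT invr_eq0 pnatr_eq0 => /eqP n0.
by move: dim_gt0; rewrite lt0n => /eqP.
Qed.

(** First order optimality on the segment from [tau] to [sigma]: by minimality and [relent_gap] the
    linear increase is at most the gap, which is of higher order. *)
Lemma rains_set_le rho sigma : rains_minimizes side tau rho -> rains_set side sigma ->
  Re (\tr (Lmap tau rho *m sigma)) <= Re (\tr rho).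
Proof.
move=> hr hs; have kr := rains_minimizes_ker hr.
have rp : psdmx rho := hr.1.1.
have rV := herm_eigdec (psdmx_herm rp).
move: (spectralmx rho) (eigval rho) rV => V l rV.
have l0 i := psd_eigdec_ge0 i rp rV.
(* The coordinates are known to vanish on the kernel of [tau] only for nonzero [l m]; the other
   vectors have weight 0 and are replaced by 0. *)
pose y m i := if l m == 0 then 0 else (spectralmx tau *m adj V) i m.
have ym m i : eigval tau i = 0 -> y m i = 0.
  rewrite /y => ai; case: eqP => // lm.
  by case: (ker_sub_coord m tP rV kr ai).
have /choice[K HK] : forall m, exists K, 0 <= K /\ forall (r : R) Q x,
  0 < r -> r ^+ 2 <= 2^-1 ->
  eigdec ((1 - r ^+ 2)%:C *: tau + (r ^+ 2)%:C *: sigma) Q x ->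
  gap (Q *m adj (spectralmx tau)) x (eigval tau) (y m) <= K * r ^+ 3.
  by move=> m; have [K] := gap_le_cube taup hs.1 tP (ym m); exists K.
have rE := ker_sub_supp tP (psdmx_herm rp) kr.
have trE : Re (\tr (Lmap tau rho *m tau)) = Re (\tr rho).
  by rewrite (mxtrace_Lmap_self taup rE).
apply: (@segment_descent _ (\sum_m l m * K m)).
  by apply: sumr_ge0 => m _; rewrite mulr_ge0 //; case: (HK m).
move=> r r0 r2; set t := r ^+ 2 in r2 *.
have t0 : 0 <= t by rewrite sqr_ge0.
have t1 : t < 1 by lra.
have t01 : 0 <= t <= 1 by rewrite t0 ltW.
have hc := rains_set_convex htau hs t01.
have := rains_minimizes_le hr hc.
have kc := segment_ker taup hs.1 t0 t1.
set taut := _ + _ in hc kc *.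
have tQ := herm_eigdec (psdmx_herm hc.1).
rewrite relent_leE //; last by move=> v /kc /kr.
rewrite (relent_gap (psdmx_herm taup) tQ rV kr).
have -> : Re (\tr (Lmap tau rho *m taut)) =
    (1 - t) * Re (\tr rho) + t * Re (\tr (Lmap tau rho *m sigma)).
  by rewrite /taut mulmxDr -!scalemxAr mxtrace_conv trE.
set S := \sum_m _ * gap _ _ _ _.
have : S <= (\sum_m l m * K m) * r ^+ 3.
  rewrite mulr_suml; apply: ler_sum => m _; rewrite -mulrA.
  have [->|lm] := eqVneq (l m) 0; first by rewrite !mul0r.
  apply: ler_wpM2l => //; have [_ /(_ r _ _ r0 r2 tQ)] := HK m.
  by rewrite /y (negPf lm).
lra.
Qed.

Lemma mxtrace_herm_le (A B B' : 'M[C]_(n1 * n2)) :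
  A \is hermsymmx -> B \is hermsymmx -> B' \is hermsymmx ->
  (\tr (A *m B) <= \tr (A *m B')) = (Re (\tr (A *m B)) <= Re (\tr (A *m B'))).
Proof.
by move=> Ah Bh Bh'; rewrite (mxtrace_herm_mul Ah Bh) (mxtrace_herm_mul Ah Bh') lecR.
Qed.

Lemma rains_minimizes_dual rho : rains_minimizes side tau rho ->
  rains_dual side tau (Lmap tau rho) /\ rho = Lmap_pinv tau (Lmap tau rho).
Proof.
move=> hr; have kr := rains_minimizes_ker hr; have [rp tr1] := hr.1.
have rE := ker_sub_supp tP (psdmx_herm rp) kr.
have Lh := Lmap_herm tau (psdmx_herm rp).
have LK : Lmap_pinv tau (Lmap tau rho) = rho by rewrite (Lmap_K taup) rE.
split; last by rewrite LK.
have Ltau : \tr (Lmap tau rho *m tau) = \tr rho by rewrite (mxtrace_Lmap_self taup rE).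
split; [exact: Lh | split | by rewrite LK | by rewrite (supp_Lmap taup)].
  move=> t ht; rewrite (mxtrace_herm_le Lh (psdmx_herm ht.1) (psdmx_herm taup)) Ltau.
  exact: rains_set_le.
by rewrite Ltau.
Qed.

Lemma rains_dual_Lmap phi : rains_dual side tau phi -> Lmap tau (Lmap_pinv tau phi) = phi.
Proof. by move=> [_ _ _ E]; rewrite (Lmap_pinvK taup) -E. Qed.

(** With [phi = Lmap tau rho], the supporting inequality makes the linear part of [relent_gap]
    nonpositive, and the gap is nonnegative; a [sigma] of infinite relative entropy needs no
    argument. *)
Lemma rains_dual_minimizes phi : rains_dual side tau phi ->
  rains_minimizes side tau (Lmap_pinv tau phi).
Proof.
move=> hd; have LK := rains_dual_Lmap hd; have [ph [psup ptau] rp _] := hd.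
have rE := supp_Lmap_pinv taup phi.
move: (Lmap_pinv tau phi) LK rp rE => rho LK rp rE.
have kr := supp_ker_sub tP rE.
have tr1 : \tr rho = 1 by rewrite -(mxtrace_Lmap_self taup rE) LK.
split=> //; apply/eqP; rewrite eq_le; apply/andP; split.
  by apply: ereal_inf_lbound; exists tau.
apply: le_ereal_inf_tmp => _ [sigma hs <-].
have [ks|/relentNE->] := pselect (ker_sub sigma rho); last by rewrite leey.
rewrite relent_leE //.
have sQ := herm_eigdec (psdmx_herm hs.1).
have rV := herm_eigdec (psdmx_herm rp).
rewrite (relent_gap (psdmx_herm taup) sQ rV kr) LK.
have : Re (\tr (phi *m sigma)) <= Re (\tr rho).
  have := psup sigma hs.
  by rewrite (mxtrace_herm_le ph (psdmx_herm hs.1) (psdmx_herm taup)) ptau tr1.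
set S := \sum_m _.
suff : 0 <= S by lra.
apply: sumr_ge0 => m _.
have [->|lm] := eqVneq (eigval rho m) 0; first by rewrite mul0r.
apply: mulr_ge0; first exact: psd_eigdec_ge0 rp rV.
apply: gap_ge0 => [i|k|k xk].
- exact: psd_eigdec_ge0 taup tP.
- exact: psd_eigdec_ge0 hs.1 sQ.
(* The sum required by [gap_ge0] is the overlap of the [m]-th eigenvector of [rho] with an
   eigenvector in the kernel of [sigma], expanded in the eigenbasis of [tau]. *)
case: (ker_sub_coord m sQ rV ks xk) => [l0|]; first by rewrite l0 eqxx in lm.
have -> : spectralmx sigma *m adj (spectralmx rho) =
    (spectralmx sigma *m adj (spectralmx tau)) *m (spectralmx tau *m adj (spectralmx rho)).
  by rewrite !mulmxA (mulmxKU _ (eigdec_unitary tP)).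
by rewrite [X in X = _ -> _]mxE.
Qed.

(** A zero eigenvalue would make a whole row of the unitary overlap matrix vanish, as [rho] has no
    zero eigenvalue. *)
Lemma rains_minimizes_posdef rho i : rains_minimizes side tau rho -> posdefmx rho ->
  eigval tau i != 0.
Proof.
move=> hr rp; have kr := rains_minimizes_ker hr.
have rV := herm_eigdec rp.1.
have lp m := posdef_eigdec_gt0 m rp rV.
apply/eqP => ai.
have Wu := mul_unitary (eigdec_unitary tP) (adj_unitary (eigdec_unitary rV)).
have := sum_normsq_row i Wu; rewrite big1 => [/esym/eqP|m _]; first by rewrite oner_eq0.
case: (ker_sub_coord m tP rV kr ai) => [l0|->]; last exact: normsq0.
by have := lp m; rewrite l0 ltxx.
Qed.

Lemma rank_eigval : (forall i, eigval tau i != 0) -> \rank tau = (n1 * n2)%N.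
Proof.
move=> a0; have Pu := eigdec_unitary tP.
suff /mulmx1_unit[/mxrank_unit] :
  tau *m (adj (spectralmx tau) *m dg (fun i => (eigval tau i)^-1) *m spectralmx tau) = 1%:M.
  by [].
rewrite [X in X *m _ = _](eigdecE tP) !mulmxA (mulmxUK _ Pu) -[_ *m dg _ *m dg _]mulmxA mul_dg.
rewrite (@eq_dg _ _ _ (fun=> 1)) => [|i]; last by rewrite mulfV.
by rewrite dg1 mulmx1 (unitaryC Pu).
Qed.

End Theorem10.


Theorem theorem10 (R : realType) (n1 n2 : nat) (side : bool)
    (tau : 'M[R[i]]_(n1 * n2))
    (htau : rains_set side tau) (htau1 : trnorm (ptransp side tau) = 1) :
  [/\ (exists rho : 'M[R[i]]_(n1 * n2), rains_minimizes side tau rho) <->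
      (exists phi : 'M[R[i]]_(n1 * n2), rains_dual side tau phi),
      (forall rho : 'M[R[i]]_(n1 * n2), rains_minimizes side tau rho ->
         exists phi : 'M[R[i]]_(n1 * n2),
           rains_dual side tau phi /\ rho = Lmap_pinv tau phi),
      (forall phi : 'M[R[i]]_(n1 * n2), rains_dual side tau phi -> psdmx phi)
    & (forall rho phi : 'M[R[i]]_(n1 * n2),
         rains_minimizes side tau rho ->
         rains_dual side tau phi ->
         rho = Lmap_pinv tau phi ->
         posdefmx rho ->
         [/\ \rank tau = (n1 * n2)%N, phi = Lmap tau rho & posdefmx phi])].
Proof.
have taup : psdmx tau := htau.1.
split.
- split=> [[rho hr]|[phi hd]].
    by exists (Lmap tau rho); case: (rains_minimizes_dual htau htau1 hr).
  by exists (Lmap_pinv tau phi); exact (rains_dual_minimizes htau hd).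
- move=> rho hr; exists (Lmap tau rho); exact (rains_minimizes_dual htau htau1 hr).
(* By (iii), [phi] is the image under [Lmap tau] of [Lmap_pinv tau phi], which (ii) makes positive
   semidefinite. *)
- move=> phi hd; rewrite -(rains_dual_Lmap htau hd).
  by apply: (Lmap_psd taup); case: hd.
move=> rho phi hr hd E rp.
have a0 i := rains_minimizes_posdef htau htau1 i hr rp.
have pE : phi = Lmap tau rho by rewrite E (rains_dual_Lmap htau hd).
split; [exact: (rank_eigval htau a0) | exact: pE |].
rewrite pE; exact: (Lmap_posdef taup a0 rp).
Qed.
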